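(* Let $q\in L^1(0,\infty)$ be real-valued and let $H^N$ be the self-adjoint operator in $L^2(0,\infty)$ given by $H^N\varphi=-\varphi''+(x+q(x))\varphi$ on the domain of $\varphi\in L^2(0,\infty)$ with $\varphi,\varphi'$ locally absolutely continuous on $[0,\infty)$, $-\varphi''+(x+q)\varphi\in L^2(0,\infty)$, and $\varphi'(0)=0$. Let $\lambda_1^N<\lambda_2^N<\cdots$ be its (simple) eigenvalues, and define the norming constants $\nu_k^N$ by \[ \frac{1}{\nu_k^N}=\frac{\|\varphi_k\|_{L^2(0,\infty)}^2}{\big(\varphi_k(0)\big)^2}, \] where $\varphi_k$ is any nonzero eigenfunction of $H^N$ for $\lambda_k^N$. Then \[ \frac{1}{\nu_k^N}=\left(\tfrac32\pi\big(k-\tfrac34\big)\right)^{2/3}\big(1+o(1)\big),\qquad k\to\infty. \]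
   Context: The quotient defining $\nu_k^N$ does not depend on the choice of the (one-dimensional) eigenfunction $\varphi_k$. *)

(* Defs.v *)
From mathcomp Require Import all_boot all_order all_algebra.
From mathcomp Require Import all_classical all_reals all_analysis.
Set Implicit Arguments. Unset Strict Implicit. Unset Printing Implicit Defensive.
Import Order.TTheory GRing.Theory Num.Theory.
Local Open Scope classical_set_scope.
Local Open Scope ring_scope.

Definition L1_halfline (R : realType) (q : R -> R) : Prop :=
  (@lebesgue_measure R).-integrable `[0%R, +oo[ (EFin \o q).

(* phi is a nonzero eigenfunction of the Neumann operator
   H^N phi = -phi'' + (x + q x) phi, phi'(0) = 0, for the eigenvalue lam.
   Local absolute continuity of phi and phi' is written out: phi is the
   indefinite integral of psi (= phi') on [0,x], and psi is the indefinite
   integral of its a.e. derivative phi'' = (t + q t - lam) phi t, which is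
   the eigenvalue equation -phi'' + (x+q) phi = lam phi. *)
Definition neumann_eigenfunction (R : realType) (q : R -> R) (lam : R)
    (phi : R -> R) : Prop :=
  [/\ exists x, 0 <= x /\ phi x != 0,
      (@lebesgue_measure R).-integrable `[0%R, +oo[ (fun x => (phi x ^+ 2)%:E)
    & exists psi : R -> R,
      psi 0 = 0 /\
      forall x, 0 <= x ->
        [/\ (@lebesgue_measure R).-integrable `[0%R, x] (EFin \o psi),
            (@lebesgue_measure R).-integrable `[0%R, x]
               (fun t => ((t + q t - lam) * phi t)%:E),
            phi x = phi 0 + Rintegral (@lebesgue_measure R) `[0%R, x] psi
          & psi x = psi 0 + Rintegral (@lebesgue_measure R) `[0%R, x]
               (fun t => (t + q t - lam) * phi t)]].

Definition neumann_eigenvalue (R : realType) (q : R -> R) (lam : R) : Prop :=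
  exists phi, neumann_eigenfunction q lam phi.

Definition inv_norming (R : realType) (phi : R -> R) : R :=
  Rintegral (@lebesgue_measure R) `[0%R, +oo[ (fun x => phi x ^+ 2) / phi 0 ^+ 2.

(* Main.v *)
Require Import Defs.
From mathcomp Require Import all_boot all_order all_algebra.
From mathcomp Require Import all_classical all_reals all_analysis.
From mathcomp Require Import measurable_realfun ring lra.
Set Implicit Arguments. Unset Strict Implicit. Unset Printing Implicit Defensive.
Import Order.TTheory GRing.Theory Num.Theory numFieldNormedType.Exports.
Local Open Scope classical_set_scope.
Local Open Scope ring_scope.

(* Put [c x = \int_x^oo q]. For a solution [u] of [- u'' + (x + q) u = lam u] the
   quasi-derivative [v = u' + c u] is continuously differentiable, and
     u' = v - c u,   v' = (x - lam - c^2) u + c v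
   is a linear system with continuous coefficients. In polar coordinates
   [u = r sin th, v = r cos th] the angle obeys a scalar Lipschitz equation,
   nondecreasing in [lam].

   Far beyond the turning point [x = lam] the quantity [u (u + v)] is strictly
   increasing; either it stays negative, and [u] is square integrable, or it
   becomes positive, and [u] is not. Hence the number of zeros of [u] is locally
   constant away from the eigenvalues and jumps by at most one at each of them;
   by a Wronskian argument it does jump. So the [n]-th eigenvalue has [m0 + n]
   zeros, while a variable rescaling of the angle gives
   [th lam = (2/3) lam^(3/2) + O(lam)] at the turning point. Therefore
   [lam_n ~ (3 pi n / 2)^(2/3)].

   For an eigenfunction with [u 0 = 1], the energy [u'^2 + (lam - x) u^2] has
   derivative [- u^2 + 2 q u u'] and vanishes at infinity, whence
   [\int u^2 = lam + 2 \int q u u']. On a fixed interval carrying most of the mass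
   of [q], [u u' = O(sqrt lam)], and [u u' = O(lam)] everywhere, so the last
   integral is [o(lam)]. *)

(** Since [q] is merely integrable, [u''] exists only almost everywhere. Hiding [q] in its tail
    integral makes [u] and [v] continuously differentiable, so the mean value theorem and the
    classical fundamental theorem apply to them. Where [q] itself must appear it stays under an
    integral, and [rint_prod] supplies the product rule. The tail is taken from infinity rather than
    from 0 so that [c] tends to 0 and cannot spoil the signs beyond the turning point.

    The bound on [u u'] is circular at first sight: beyond the turning point it uses the mass of
    [u^2], which is the quantity being estimated, and that mass depends on [\int q u u']. The circle
    is broken by cutting at a point [X] past which [q] has mass at most a small [eps], so that the
    circular contribution is absorbed. *)

Local Notation mu := lebesgue_measure.

(** * Calculus on the half-line *)

Section Calculus.
Context {R : realType}.
Implicit Types (f g F : R -> R) (a b x y : R).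

Lemma continuous_forP f x : {for x, continuous f} <->
  (forall e : R, 0 < e -> exists2 d : R, 0 < d &
    forall y, `|y - x| < d -> `|f y - f x| < e).
Proof.
split=> [cf e e0|H].
  have /cvgrPdist_lt /(_ e e0) := cf.
  rewrite near_simpl => /nbhs_ballP[d /= d0 H]; exists d => // y yx.
  by rewrite distrC; apply: H; rewrite /ball /= distrC.
apply/cvgrPdist_lt => e e0; have [d d0 H'] := H e e0.
rewrite near_simpl; apply/nbhs_ballP; exists d => //= y.
by rewrite /ball /= distrC => /H'; rewrite distrC.
Qed.

Lemma is_derive_continuous F x (l : R) :
  is_derive x 1 F l -> {for x, continuous F}.
Proof. by move=> [dF _]; exact/differentiable_continuous/derivable1_diffP. Qed.

Lemma derive_mvt F f a b : a < b ->
  (forall x, a <= x <= b -> is_derive x 1 F (f x)) ->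
  exists2 c, a < c < b & F b - F a = f c * (b - a).
Proof.
move=> ab dF.
have [x| |c] := @MVT R F f a b ab.
- by rewrite in_itv /= => /andP[/ltW ? /ltW ?]; apply: dF; apply/andP.
- apply: continuous_in_subspaceT => x; rewrite inE /= in_itv /= => xab.
  exact: is_derive_continuous (dF x xab).
by rewrite in_itv /= => cab E; exists c.
Qed.

Lemma derive_ge0_le F f a b : a <= b ->
  (forall x, a <= x <= b -> is_derive x 1 F (f x)) ->
  (forall x, a <= x <= b -> 0 <= f x) -> F a <= F b.
Proof.
rewrite le_eqVlt => /predU1P[->//|ab dF f0].
have [c /andP[ac cb] E] := derive_mvt ab dF.
by rewrite -subr_ge0 E mulr_ge0 ?subr_ge0 ?f0 ?ltW // ?ac.
Qed.

Lemma derive_gt0_lt F f a b : a < b ->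
  (forall x, a <= x <= b -> is_derive x 1 F (f x)) ->
  (forall x, a < x < b -> 0 < f x) -> F a < F b.
Proof.
move=> ab dF f0; have [c cab E] := derive_mvt ab dF.
by rewrite -subr_gt0 E mulr_gt0 ?subr_gt0 ?f0.
Qed.

Lemma derive_eq F G f a b : a <= b ->
  (forall x, a <= x <= b -> is_derive x 1 F (f x)) ->
  (forall x, a <= x <= b -> is_derive x 1 G (f x)) -> F b - F a = G b - G a.
Proof.
rewrite le_eqVlt => /predU1P[->|ab dF dG]; first by rewrite !subrr.
have dFG x : a <= x <= b -> is_derive x 1 (fun x => F x - G x) 0.
  move=> xab; have := dF _ xab; have := dG _ xab => ? ?.
  by apply: is_derive_eq; rewrite subrr.
have [c cab] := derive_mvt ab dFG.
by move=> E; apply/eqP; rewrite -subr_eq0; apply/eqP; lra.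
Qed.

Definition cont_ge0 f := forall x, 0 <= x -> {for x, continuous f}.

Lemma cont_ge0_within f a b : 0 <= a -> cont_ge0 f ->
  {within `[a, b], continuous f}.
Proof.
move=> a0 cf; apply: continuous_in_subspaceT => x.
rewrite inE /= in_itv /= => /andP[ax _]; apply: cf; exact: le_trans ax.
Qed.

Lemma cont_ge0_ivt f a b v : 0 <= a -> a <= b -> cont_ge0 f ->
  f a <= v <= f b -> exists2 c, a <= c <= b & f c = v.
Proof.
move=> a0 ab cf /andP[av vb].
have [|c] := @IVT R f a b v ab (cont_ge0_within a0 cf).
- by rewrite ge_min av /= le_max vb orbT.
by rewrite in_itv /= => cab E; exists c.
Qed.

(* The hypothesis says that [D] varies infinitesimally slower than [W] at every
   point; the conclusion is the mean value theorem relative to [dW]. *)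
Lemma const_of_little_osc (D W : R -> R) a b : a <= b ->
  (forall x y, a <= x -> x <= y -> y <= b -> W x <= W y) ->
  (forall x (e : R), a <= x <= b -> 0 < e -> exists2 d : R, 0 < d &
     forall y, a <= y <= b -> `|y - x| < d -> `|D y - D x| <= e * `|W y - W x|) ->
  D b = D a.
Proof.
move=> ab Wnd H.
suff key (e : R) : 0 < e -> `|D b - D a| <= e * (W b - W a).
  apply/eqP; rewrite -subr_eq0 -normr_le0; apply/ler_addgt0Pl => e e0.
  have W0 : 0 <= W b - W a by rewrite subr_ge0 Wnd.
  have {}e0 : 0 < e / (W b - W a + 1) by rewrite divr_gt0 //; lra.
  apply: (le_trans (key _ e0)); rewrite addr0 mulrAC ler_pdivrMr; last by lra.
  have : 0 < e by rewrite -(pmulr_lgt0 _ (x := (W b - W a + 1)^-1)) // invr_gt0; lra.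
  nra.
move=> e0.
(* Real induction: the supremum [s] of [S] belongs to [S] by the local estimate on its left, and the
   same estimate on its right would push it further if [s < b]. *)
pose S := [set x | a <= x <= b /\ `|D x - D a| <= e * (W x - W a)].
have Sa : S a by split; [rewrite lexx ab | rewrite !subrr normr0 mulr0].
have ubS : has_ubound S by exists b => x [/andP[]].
have supS : has_sup S by split => //; exists a.
set s := sup S.
have as_ : a <= s by apply: ub_le_sup.
have sb : s <= b by apply: ge_sup; [exists a|move=> x [/andP[]]].
have step (x y : R) : S x -> x <= y -> y <= b -> `|D y - D x| <= e * `|W y - W x| -> S y.
  move=> [/andP[ax xb] Sx] xy yb Dyx; split; first by rewrite (le_trans ax).
  rewrite (_ : D y - D a = (D y - D x) + (D x - D a)); last by ring.
  apply: (le_trans (ler_normD _ _)).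
  rewrite (ger0_norm (_ : 0 <= W y - W x)) in Dyx; last by rewrite subr_ge0 Wnd.
  lra.
have [d d0 Hd] := H s e (introT andP (conj as_ sb)) e0.
have Ss : S s.
  have [x Sx sdx] := sup_adherent d0 supS.
  have xs : x <= s by apply: ub_le_sup.
  apply: (step x) => //; rewrite distrC (distrC (W s)); apply: Hd.
    by case: Sx.
  by rewrite -/s in sdx; rewrite ler0_norm; lra.
have [/eqP|sb'] := eqVneq s b; first by move=> /eqP <-; case: Ss.
have {}sb' : s < b by rewrite lt_neqAle sb' sb.
pose y := Num.min b (s + d / 2).
have sy : s < y by rewrite lt_min sb' /=; lra.
have yb : y <= b by rewrite ge_min lexx.
have Sy : S y.
  apply: (step s) => //; first exact: ltW.
  apply: Hd; first by rewrite yb (le_trans as_ (ltW sy)).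
  have : y <= s + d / 2 by rewrite ge_min lexx orbT.
  by rewrite ger0_norm; lra.
have : y <= s by apply: ub_le_sup.
by rewrite leNgt sy.
Qed.

End Calculus.

(** * Primitives of locally integrable functions *)

Section Primitive.
Context {R : realType}.
Implicit Types (f g F : R -> R) (a b x y : R).

Definition rint f x : R := \int[mu]_(t in `[0, x]) f t.

Definition lint f := forall x, 0 <= x -> mu.-integrable `[0, x] (EFin \o f).

Lemma cont_ge0_lint f : cont_ge0 f -> lint f.
Proof.
move=> cf x x0; apply: continuous_compact_integrable.
  exact: segment_compact.
exact: cont_ge0_within.
Qed.

Lemma lintN f : lint f -> lint (fun t => - f t).
Proof. by move=> If x x0; have := integrableN (If x x0); apply. Qed.

Lemma lintD f g : lint f -> lint g -> lint (fun t => f t + g t).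
Proof.
move=> If Ig x x0.
by have := integrableD _ (If x x0) (Ig x x0); apply.
Qed.

Lemma lint_norm f : lint f -> lint (fun t => `|f t|).
Proof. by move=> If x x0; exact: integrable_norm (If x x0). Qed.

Lemma lintM f w : lint f -> cont_ge0 w -> lint (fun t => f t * w t).
Proof.
move=> If cw x x0.
have cw' : {within `[0, x], continuous w} by exact: cont_ge0_within.
have := integrableMl _ (If x x0); apply => //.
  exact: (subspace_continuous_measurable_fun (measurable_itv _) cw').
have /compact_bounded := continuous_compact cw' (@segment_compact _ 0 x).
by move=> [M [Mr H]]; exists M; split => // y /H {}H z zx; apply: H; exists z.
Qed.

Lemma eq_rint f g x : (forall t, 0 <= t -> f t = g t) -> rint f x = rint g x.
Proof.
move=> fg; apply: eq_Rintegral => t.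
by rewrite inE /= in_itv /= => /andP[t0 _]; rewrite fg.
Qed.

Lemma rint0 f : rint f 0 = 0.
Proof. by rewrite /rint set_itv1 Rintegral_set1. Qed.

Lemma rintD f g x : lint f -> lint g -> 0 <= x ->
  rint (fun t => f t + g t) x = rint f x + rint g x.
Proof.
by move=> If Ig x0; apply: RintegralD => //; [exact: If|exact: Ig].
Qed.

Lemma rintB f g x : lint f -> lint g -> 0 <= x ->
  rint (fun t => f t - g t) x = rint f x - rint g x.
Proof.
by move=> If Ig x0; apply: RintegralB => //; [exact: If|exact: Ig].
Qed.

Lemma rintZ f (k : R) x : lint f -> 0 <= x ->
  rint (fun t => k * f t) x = k * rint f x.
Proof. by move=> If x0; apply: RintegralZl => //; exact: If. Qed.

Lemma lintZ f (k : R) : lint f -> lint (fun t => k * f t).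
Proof.
move=> If x x0.
by have := integrableZl _ k (If x x0); apply.
Qed.

Lemma rint_chasles f x y : lint f -> 0 <= x -> x <= y ->
  rint f y - rint f x = \int[mu]_(t in `]x, y]) f t.
Proof.
move=> If x0 xy; apply: Rintegral_itvB; last 2 first.
- by rewrite bnd_simp.
- by rewrite bnd_simp.
exact: If (le_trans x0 xy).
Qed.

Lemma lint_sub f x y : lint f -> 0 <= x -> x <= y ->
  mu.-integrable `]x, y] (EFin \o f).
Proof.
move=> If x0 xy; apply: integrableS (If y (le_trans x0 xy)) => //.
by apply: subset_itvr; rewrite bnd_simp.
Qed.

Lemma rint_norm_le f g x y : lint f -> lint g -> 0 <= x -> x <= y ->
  (forall t, x <= t <= y -> `|f t| <= g t) ->
  `|rint f y - rint f x| <= rint g y - rint g x.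
Proof.
move=> If Ig x0 xy fg; rewrite !rint_chasles //.
apply: (le_trans (le_normr_Rintegral _ (lint_sub If x0 xy))) => //.
apply: le_Rintegral => //.
- exact: lint_sub (lint_norm If) x0 xy.
- exact: lint_sub.
by move=> t /=; rewrite in_itv /= => /andP[/ltW xt ty]; apply: fg; rewrite xt.
Qed.

Lemma rint_norm_le0 f g x : lint f -> lint g -> 0 <= x ->
  (forall t, 0 <= t <= x -> `|f t| <= g t) -> `|rint f x| <= rint g x.
Proof.
move=> If Ig x0 fg.
by have := rint_norm_le If Ig (lexx 0) x0 fg; rewrite !rint0 !subr0.
Qed.

Lemma rint_nd f x y : lint f -> (forall t, 0 <= t -> 0 <= f t) ->
  0 <= x -> x <= y -> rint f x <= rint f y.
Proof.
move=> If f0 x0 xy; rewrite -subr_ge0 rint_chasles //; apply: Rintegral_ge0.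
move=> t /=; rewrite in_itv /= => /andP[/ltW xt ty]; apply: f0.
exact: le_trans xt.
Qed.

Lemma rint_ge0 f x : (forall t, 0 <= t -> 0 <= f t) -> 0 <= rint f x.
Proof.
move=> f0; apply: Rintegral_ge0 => t /=.
by rewrite in_itv /= => /andP[t0 _]; exact: f0.
Qed.

Lemma cont_rint f : lint f -> cont_ge0 (rint f).
Proof.
move=> If x; rewrite le_eqVlt => /predU1P[<-|x0].
  rewrite /prop_for /continuous_at rint0.
  by apply: (@parameterized_integral_cvg_left _ 0 1) => //; exact: If.
have x1 : 0 < x + 1 by rewrite addr_gt0.
have := parameterized_integral_continuous (ltW x1) (If _ (ltW x1)).
move=> /(continuous_within_itvP _ x1)[H _ _]; apply: H.
by rewrite in_itv /= x0 /= ltrDl.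
Qed.

(* Extending the integrand by its value at [0] makes the primitive
   differentiable from both sides at [0]. *)
Definition prim f x : R :=
  \int[mu]_(t in `[-1, x]) f (Num.max t 0)
  - \int[mu]_(t in `[-1, 0]) f (Num.max t 0).

Lemma continuous_max0 f : cont_ge0 f -> continuous (fun t : R => f (Num.max t 0)).
Proof.
move=> cf t.
apply: (@continuous_comp _ _ _ (fun t : R => Num.max t 0) f).
  exact: (@continuous_max _ _ (fun t : R => t) (fun=> 0) t cvg_id (cvg_cst _)).
by apply: cf; rewrite le_max lexx orbT.
Qed.

Lemma prim_rint f x : cont_ge0 f -> 0 <= x -> prim f x = rint f x.
Proof.
move=> cf x0; rewrite /prim.
have If : mu.-integrable `[-1, x] (EFin \o (fun t : R => f (Num.max t 0))).
  apply: continuous_compact_integrable; first exact: segment_compact.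
  by apply: continuous_subspaceT; exact: continuous_max0.
rewrite Rintegral_itvB //; last by rewrite bnd_simp lerN10.
rewrite Rintegral_itv_obnd_cbnd; last first.
  by apply: integrableS If => //; apply: subset_itvr; rewrite bnd_simp; lra.
apply: eq_Rintegral => t; rewrite inE /= in_itv /= => /andP[t0 _].
by rewrite max_l.
Qed.

Lemma prim_derive f x : cont_ge0 f -> 0 <= x -> is_derive x 1 (prim f) (f x).
Proof.
move=> cf x0.
have cg := continuous_max0 cf.
have [||||d E] := @continuous_FTC1_closed R (fun t : R => f (Num.max t 0)) (-1) x (x + 1).
- by rewrite ltrDl.
- apply: continuous_compact_integrable; first exact: segment_compact.
  by apply: continuous_subspaceT.
- by lra.
- exact: cg.
have D : is_derive x 1 (fun x => \int[mu]_(t in `[-1, x]) f (Num.max t 0)) (f x).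
  by apply: DeriveDef; [exact: d|rewrite -derive1E E max_l].
by rewrite /prim; apply: is_derive_eq; rewrite subr0.
Qed.

Lemma cont_prim f : cont_ge0 f -> cont_ge0 (prim f).
Proof. by move=> cf x x0; exact: is_derive_continuous (prim_derive cf x0). Qed.

Lemma cont_ge0D f g : cont_ge0 f -> cont_ge0 g -> cont_ge0 (fun x => f x + g x).
Proof. by move=> cf cg x x0; apply: cvgD; [exact: cf|exact: cg]. Qed.

Lemma cont_ge0B f g : cont_ge0 f -> cont_ge0 g -> cont_ge0 (fun x => f x - g x).
Proof. by move=> cf cg x x0; apply: cvgB; [exact: cf|exact: cg]. Qed.

Lemma cont_ge0M f g : cont_ge0 f -> cont_ge0 g -> cont_ge0 (fun x => f x * g x).
Proof. by move=> cf cg x x0; apply: cvgM; [exact: cf|exact: cg]. Qed.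

Lemma cont_ge0X f n : cont_ge0 f -> cont_ge0 (fun x => f x ^+ n).
Proof.
by move=> cf x x0; apply: (continuous_comp (g := fun y => y ^+ n)); [exact: cf|exact: exprn_continuous].
Qed.

Lemma cont_ge0_cst (k : R) : cont_ge0 (fun=> k).
Proof. by move=> x x0; exact: cvg_cst. Qed.

Lemma cont_ge0_id : cont_ge0 (fun x : R => x).
Proof. by move=> x x0; exact: cvg_id. Qed.

Lemma cont_ge0_comp (h : R -> R) f : continuous h -> cont_ge0 f -> cont_ge0 (fun x => h (f x)).
Proof. by move=> ch cf x x0; exact: continuous_comp (cf x x0) (ch _). Qed.

Lemma cont_ge0_norm f : cont_ge0 f -> cont_ge0 (fun x => `|f x|).
Proof. by move=> cf x x0; apply: cvg_norm; exact: cf. Qed.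

Lemma derive_rint F f x : cont_ge0 f ->
  (forall x, 0 <= x -> is_derive x 1 F (f x)) -> 0 <= x -> rint f x = F x - F 0.
Proof.
move=> cf dF x0; have <- : rint f x - rint f 0 = rint f x by rewrite rint0 subr0.
rewrite -!prim_rint //.
by apply: (derive_eq (f := f)) => // t /andP[t0 _]; [exact: prim_derive|exact: dF].
Qed.

(** Product rule for absolutely continuous functions. The primitives need not be differentiable
    anywhere prescribed, so the difference of the two sides is compared with the increments of [W],
    the primitive of [|f| + |g|]: near each point it varies infinitesimally slower than [W], hence
    is constant. *)
Lemma rint_prod f g a b x : lint f -> lint g -> 0 <= x ->
  (a + rint f x) * (b + rint g x) =
  a * b + rint (fun t => f t * (b + rint g t) + g t * (a + rint f t)) x.
Proof.
move=> If Ig x0.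
have cF : cont_ge0 (fun t => a + rint f t).
  by apply: cont_ge0D; [exact: cont_ge0_cst|exact: cont_rint].
have cG : cont_ge0 (fun t => b + rint g t).
  by apply: cont_ge0D; [exact: cont_ge0_cst|exact: cont_rint].
have I1 := lintM If cG; have I2 := lintM Ig cF.
have I3 := lintD I1 I2.
have IW := lintD (lint_norm If) (lint_norm Ig).
pose W := rint (fun t => `|f t| + `|g t|).
pose D t := (a + rint f t) * (b + rint g t) -
  rint (fun t => f t * (b + rint g t) + g t * (a + rint f t)) t.
suff : D x = D 0 by rewrite /D !rint0 !addr0 subr0 => /eqP; rewrite subr_eq => /eqP.
have Wnd s t : 0 <= s -> s <= t -> W s <= W t.
  by move=> s0 st; apply: rint_nd => // r _; rewrite addr_ge0.
apply: (const_of_little_osc (W := W)) => // [s t s0 st _|z e /andP[z0 zx] e0].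
  exact: Wnd.
have e20 : 0 < e / 3 by lra.
have /continuous_forP/(_ _ e20)[d1 d10 H1] := cF z z0.
have /continuous_forP/(_ _ e20)[d2 d20 H2] := cG z z0.
exists (Num.min d1 d2); first by rewrite lt_min d10.
suff key s t : 0 <= s -> s <= t -> (forall r, s <= r <= t ->
    `|r - z| < Num.min d1 d2) -> `|D t - D s| <= e * (W t - W s).
  move=> y /andP[y0 yx]; case: (leP y z) => [yz|/ltW zy] yd.
    rewrite distrC (distrC (W y)) (ger0_norm (_ : 0 <= W z - W y)) ?subr_ge0 ?Wnd //.
    apply: key => // r /andP[yr rz]; apply: le_lt_trans yd.
    by rewrite !ler0_norm; lra.
  rewrite (ger0_norm (_ : 0 <= W y - W z)) ?subr_ge0 ?Wnd //.
  apply: key => // r /andP[yr rz]; apply: le_lt_trans yd.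
  by rewrite !ger0_norm; lra.
move=> s0 st near_z.
have t0 := le_trans s0 st.
have nF r : s <= r <= t -> `|rint f r - rint f z| <= e / 3.
  move=> /near_z; rewrite lt_min => /andP[rd _]; have := ltW (H1 _ rd).
  by rewrite (_ : a + rint f r - (a + rint f z) = rint f r - rint f z); last ring.
have nG r : s <= r <= t -> `|rint g r - rint g z| <= e / 3.
  move=> /near_z; rewrite lt_min => /andP[_ rd]; have := ltW (H2 _ rd).
  by rewrite (_ : b + rint g r - (b + rint g z) = rint g r - rint g z); last ring.
(* The error made by freezing both primitives at [z]: [h r] equals [f r] times the increment of
   [rint g] plus [g r] times that of [rint f], and both increments are at most [e / 3]. *)
pose h r := f r * (b + rint g r) + g r * (a + rint f r)
  - ((b + rint g z) * f r + (a + rint f z) * g r).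
have hE r : 0 <= r -> rint h r = rint (fun t => f t * (b + rint g t) + g t * (a + rint f t)) r
   - ((b + rint g z) * rint f r + (a + rint f z) * rint g r).
  move=> r0; rewrite rintB //; last by apply: lintD; exact: lintZ.
  rewrite (rintD (lintZ _ If) (lintZ _ Ig) r0) !rintZ //.
have Ih : lint h.
  by apply: lintD => //; apply: lintN; apply: lintD; exact: lintZ.
have DE : D t - D s = (rint f t - rint f s) * (rint g t - rint g z) +
    (rint g t - rint g s) * (rint f s - rint f z) - (rint h t - rint h s).
  by rewrite !hE // /D; ring.
have B0 : `|rint h t - rint h s| <= e / 3 * (W t - W s).
  rewrite mulrBr -!rintZ //; apply: rint_norm_le => //; first exact: lintZ.
  move=> r rst; rewrite (_ : h r = f r * (rint g r - rint g z) + g r * (rint f r - rint f z)).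
    apply: (le_trans (ler_normD _ _)); rewrite !normrM mulrDr.
    by apply: lerD; rewrite mulrC ler_wpM2r // ?nF ?nG.
  by rewrite /h; ring.
have WE r : 0 <= r -> W r = rint (fun t => `|f t|) r + rint (fun t => `|g t|) r.
  by move=> r0; rewrite /W rintD //; exact: lint_norm.
have B1 : `|rint f t - rint f s| <= rint (fun t => `|f t|) t - rint (fun t => `|f t|) s.
  by apply: rint_norm_le => //; exact: lint_norm.
have B2 : `|rint g t - rint g s| <= rint (fun t => `|g t|) t - rint (fun t => `|g t|) s.
  by apply: rint_norm_le => //; exact: lint_norm.
have nGt : `|rint g t - rint g z| <= e / 3 by apply: nG; rewrite st lexx.
have nFs : `|rint f s - rint f z| <= e / 3 by apply: nF; rewrite st lexx.
rewrite DE; apply: (le_trans (ler_normB _ _)).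
have : `|(rint f t - rint f s) * (rint g t - rint g z) +
   (rint g t - rint g s) * (rint f s - rint f z)| <= e / 3 * (W t - W s).
  apply: (le_trans (ler_normD _ _)); rewrite !normrM.
  rewrite (_ : W t - W s = (rint (fun t => `|f t|) t - rint (fun t => `|f t|) s) +
    (rint (fun t => `|g t|) t - rint (fun t => `|g t|) s)); last by rewrite !WE //; ring.
  by rewrite mulrDr ![e / 3 * _]mulrC; apply: lerD; apply: ler_pM.
have : 0 <= e / 3 * (W t - W s) by rewrite mulr_ge0 ?subr_ge0 ?Wnd // ltW.
lra.
Qed.

End Primitive.

(** * Scalar initial value problems *)

Section Picard.
Context {R : realType}.

Lemma exists_half_pow_lt (C e : R) : 0 < e -> exists n : nat, C * 2^-1 ^+ n < e.
Proof.
move=> e0; have [C0|C0] := leP C 0.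
  by exists 0%N; rewrite expr0 mulr1; exact: le_lt_trans e0.
exists (Num.bound (C / e)).
have H : C / e < (Num.bound (C / e))%:R.
  by apply: archi_boundP; rewrite divr_ge0 // ltW.
rewrite ltr_pdivrMr // in H.
rewrite exprVn ltr_pdivrMr ?exprn_gt0 //.
apply: (lt_le_trans H); rewrite mulrC ler_wpM2l ?(ltW e0) //.
by rewrite -natrX ler_nat ltnW // ltn_expl.
Qed.

(** The intervals of radius [2 C / 2^n] around [a n] are nested; the limit is the supremum of their
    left ends. *)
Lemma geometric_limit (a : nat -> R) (C : R) :
  (forall n, `|a n.+1 - a n| <= C * 2^-1 ^+ n) ->
  exists l, forall n, `|a n - l| <= 2 * C * 2^-1 ^+ n.
Proof.
move=> H.
have C0 : 0 <= C by have := H 0%N; rewrite expr0 mulr1; apply: le_trans.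
pose lo n := a n - 2 * C * 2^-1 ^+ n.
pose hi n := a n + 2 * C * 2^-1 ^+ n.
have lohi n : lo n <= hi n.
  have : 0 <= C * 2^-1 ^+ n by rewrite mulr_ge0 // exprn_ge0 // invr_ge0.
  by rewrite /lo /hi; lra.
have lo1 n : lo n <= lo n.+1.
  by have := H n; rewrite ler_norml /lo exprS => /andP[? ?]; lra.
have hi1 n : hi n.+1 <= hi n.
  by have := H n; rewrite ler_norml /hi exprS => /andP[? ?]; lra.
have lom n k : lo n <= lo (n + k)%N.
  by elim: k => [|k IH]; rewrite ?addn0 // addnS (le_trans IH).
have him n k : hi (n + k)%N <= hi n.
  by elim: k => [|k IH]; rewrite ?addn0 // addnS (le_trans _ IH).
have lh m n : lo m <= hi n.
  by rewrite (le_trans (lom m n)) // (le_trans (lohi _)) // addnC.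
exists (sup (range lo)) => n.
have lo_sup : lo n <= sup (range lo).
  apply: ub_le_sup; last by exists n.
  by exists (hi 0%N) => _ [m _ <-].
have sup_hi : sup (range lo) <= hi n.
  by apply: ge_sup; [exists (lo 0%N), 0%N|move=> _ [m _ <-]].
by rewrite ler_norml; move: lo_sup sup_hi; rewrite /lo /hi => ? ?; apply/andP; split; lra.
Qed.

(** The Lipschitz constant [L + t] is unbounded, so distances are measured against the weight
    [w = exp (2 L x + x^2)]. Since [w' = 2 (L + x) w], one Picard iteration halves the weighted
    distance, and the solution is obtained on the whole half-line at once. *)
Lemma picard (f : R -> R -> R) (L D y0 : R) : 0 <= L ->
  (forall y, cont_ge0 y -> cont_ge0 (fun t => f t (y t))) ->
  (forall t a b, 0 <= t -> `|f t a - f t b| <= (L + t) * `|a - b|) ->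
  (forall t, 0 <= t -> `|f t y0| <= (L + t) * D) ->
  exists2 y, y 0 = y0 & forall x : R, 0 <= x -> is_derive x 1 y (f x (y x)).
Proof.
move=> L0 cf lipf f0.
pose w (x : R) := expR (2 * L * x + x ^+ 2).
have w_cont : cont_ge0 w.
  apply: cont_ge0_comp; first exact: continuous_expR.
  by apply: cont_ge0D; [apply: cont_ge0M; [exact: cont_ge0_cst|exact: cont_ge0_id]|
    apply: cont_ge0X; exact: cont_ge0_id].
have w_ge1 x : 0 <= x -> 1 <= w x.
  by move=> x0; rewrite /w -expR0 ler_expR addr_ge0 ?mulr_ge0 ?exprn_ge0.
have cLt : cont_ge0 (fun t : R => L + t).
  by apply: cont_ge0D; [exact: cont_ge0_cst|exact: cont_ge0_id].
have cLtw : cont_ge0 (fun t : R => (L + t) * w t) by exact: cont_ge0M.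
have intw x : 0 <= x -> rint (fun t => (L + t) * w t) x = 2^-1 * (w x - 1).
  have dw (y : R) : 0 <= y -> is_derive y 1 (fun x => 2^-1 * w x) ((L + y) * w y).
    move=> y0'.
    have ? : is_derive y 1 w (expR (2 * L * y + y ^+ 2) * (2 * L + 2 * y)).
      apply: (@is_derive1_comp _ expR); apply: is_derive_eq.
      by rewrite /GRing.scale /=; ring.
    by apply: is_derive_eq; rewrite /GRing.scale /= /w; field.
  move=> x0; rewrite (derive_rint cLtw dw x0).
  by rewrite /w mulr0 expr0n addr0 expR0 mulrBr.
have D0 : 0 <= D.
  have := le_trans (normr_ge0 _) (f0 1 ler01).
  by rewrite pmulr_rge0 //; lra.
pose fix Y n := if n is n.+1 then fun x => y0 + prim (fun t => f t (Y n t)) x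
  else fun=> y0.
have cY n : cont_ge0 (Y n).
  elim: n => [|n IH] /=; first exact: cont_ge0_cst.
  by apply: cont_ge0D; [exact: cont_ge0_cst|apply: cont_prim; exact: cf].
have YS n x : 0 <= x -> Y n.+1 x = y0 + rint (fun t => f t (Y n t)) x.
  by move=> x0 /=; rewrite prim_rint //; exact: cf.
have rint_bnd g C x : cont_ge0 g -> 0 <= x ->
    (forall t, 0 <= t -> `|g t| <= (L + t) * (C * w t)) ->
    `|rint g x| <= C * (2^-1 * (w x - 1)).
  move=> cg x0 Hg; rewrite -intw // -rintZ //; last exact: cont_ge0_lint.
  apply: rint_norm_le0 => //; first exact: cont_ge0_lint.
    by apply: lintZ; exact: cont_ge0_lint.
  by move=> t /andP[t0 _]; rewrite mulrCA; exact: Hg.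
have stepY n x : 0 <= x -> `|Y n.+1 x - Y n x| <= D * w x * 2^-1 ^+ n.
  elim: n x => [|n IH] x x0.
    rewrite YS // expr0 mulr1 /= addrC addKr.
    apply: (le_trans (rint_bnd _ D x _ x0 _)).
    - by apply: cf; exact: cont_ge0_cst.
    - move=> t t0; apply: (le_trans (f0 t t0)); rewrite ler_wpM2l ?addr_ge0 //.
      by rewrite ler_peMr // w_ge1.
    - by rewrite ler_wpM2l //; have := w_ge1 x x0; lra.
  rewrite (YS n.+1) // (YS n) //.
  rewrite (_ : forall p q, y0 + p - (y0 + q) = p - q); last by move=> p q; ring.
  have c1 := cf _ (cY n.+1); have c2 := cf _ (cY n).
  rewrite -rintB //; [|exact: cont_ge0_lint|exact: cont_ge0_lint].
  apply: (le_trans (rint_bnd _ (D * 2^-1 ^+ n) x _ x0 _)).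
  - exact: cont_ge0B.
  - move=> t t0; apply: (le_trans (lipf _ _ _ t0)).
    by rewrite ler_wpM2l ?addr_ge0 // mulrAC; exact: IH.
  - have := w_ge1 x x0; have : 0 <= D * 2^-1 ^+ n by rewrite mulr_ge0 // exprn_ge0 // invr_ge0.
    by rewrite exprS; nra.
(* Evaluating at [Num.max x 0] lets [choice] produce a total function; it is the limit of the
   iterates on the half-line, extended by its value at 0. *)
have limY (x : R) : exists l, forall n,
    `|Y n (Num.max x 0) - l| <= 2 * (D * w (Num.max x 0)) * 2^-1 ^+ n.
  by apply: geometric_limit => n; apply: stepY; rewrite le_max lexx orbT.
have [z Hz] := choice limY.
have Hz0 n x : 0 <= x -> `|Y n x - z x| <= 2 * (D * w x) * 2^-1 ^+ n.
  by move=> x0; have := Hz x n; rewrite max_l.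
have cz : cont_ge0 z.
  move=> x x0; apply/continuous_forP => e e0.
  have e30 : 0 < e / 3 by lra.
  have [n Hn] := exists_half_pow_lt (2 * (D * (w x + 1))) e30.
  have /continuous_forP/(_ _ e30)[d1 d10 H1] := continuous_max0 (cY n) (x := x).
  have /continuous_forP/(_ _ ltr01)[d2 d20 H2] := continuous_max0 w_cont (x := x).
  exists (Num.min d1 d2); first by rewrite lt_min d10.
  move=> y; rewrite lt_min => /andP[/H1 Y1 /H2 W2].
  rewrite !(max_l x0) in Y1 W2.
  have P0 : 0 <= 2^-1 ^+ n :> R by rewrite exprn_ge0 // invr_ge0.
  have Z1 := Hz y n; have Z2 := Hz0 n x x0.
  have W3 : w (Num.max y 0) <= w x + 1 by move: W2; rewrite ltr_norml => /andP[_]; lra.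
  have K1 : 2 * (D * w (Num.max y 0)) * 2^-1 ^+ n <= 2 * (D * (w x + 1)) * 2^-1 ^+ n.
    by rewrite ler_wpM2r // ler_wpM2l // ler_wpM2l.
  have K2 : 2 * (D * w x) * 2^-1 ^+ n <= 2 * (D * (w x + 1)) * 2^-1 ^+ n.
    by rewrite ler_wpM2r // ler_wpM2l // ler_wpM2l // lerDl.
  move: Z1 Z2 Y1; rewrite !ler_norml !ltr_norml => /andP[? ?] /andP[? ?] /andP[? ?].
  by apply/andP; split; lra.
have c1 := cf _ cz.
have zE x : 0 <= x -> z x = y0 + rint (fun t => f t (z t)) x.
  move=> x0; apply/eqP; rewrite -subr_eq0 -normr_le0; apply/ler_addgt0Pl => e e0.
  rewrite addr0.
  have [n Hn] := exists_half_pow_lt (2 * (D * w x)) e0.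
  have P0 : 0 <= 2^-1 ^+ n :> R by rewrite exprn_ge0 // invr_ge0.
  have Z1 := Hz0 n.+1 x x0; rewrite YS // exprS in Z1.
  have c2 := cf _ (cY n).
  have : `|rint (fun t => f t (Y n t) - f t (z t)) x|
      <= 2 * D * 2^-1 ^+ n * (2^-1 * (w x - 1)).
    apply: rint_bnd => //; first exact: cont_ge0B.
    move=> t t0; apply: (le_trans (lipf _ _ _ t0)).
    rewrite ler_wpM2l ?addr_ge0 // (le_trans (Hz0 _ _ t0)) //.
    by rewrite mulrA mulrAC.
  rewrite rintB //; [|exact: cont_ge0_lint|exact: cont_ge0_lint] => Z2.
  have := w_ge1 x x0; have : 0 <= D * 2^-1 ^+ n by rewrite mulr_ge0.
  move: Z1 Z2; rewrite !ler_norml => /andP[? ?] /andP[? ?] ? ?.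
  by apply/andP; split; nra.
exists (fun x => y0 + prim (fun t => f t (z t)) x).
  by rewrite prim_rint // rint0 addr0.
move=> x x0; rewrite prim_rint // -zE //.
have dp := prim_derive c1 x0.
apply: is_derive_eq.
by rewrite add0r mul1r.
Qed.

End Picard.

(** * The regularised equation in polar coordinates *)

Section HalfLine.
Context {R : realType}.
Variable f : R -> R.
Hypotheses (If : lint f) (f0 : forall t : R, 0 <= t -> 0 <= f t).

Lemma cvg_integral_halfline :
  (rint f n%:R)%:E @[n --> \oo] --> (\int[mu]_(t in `[0%R, +oo[) (f t)%:E)%E.
Proof.
rewrite (itv_bndy_bigcup_BRight true 0).
have E n : (rint f n%:R)%:E = (\int[mu]_(t in `[0%R, (0 + n%:R)%R]) (f t)%:E)%E.
  rewrite add0r /rint /Rintegral fineK //.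
  by apply: integrable_fin_num => //; apply: If.
under eq_fun do rewrite E.
apply: ge0_nondecreasing_set_cvg_integral => //.
- move=> m n mn; rewrite subsetEset; apply: subset_itvl.
  by rewrite bnd_simp lerD2l ler_nat.
- by move=> n; have /integrableP[] : mu.-integrable `[0, 0 + n%:R] (EFin \o f)
    by apply: If; rewrite add0r.
- by move=> n x /=; rewrite in_itv /= => /andP[x0 _]; rewrite lee_fin f0.
Qed.

Lemma integrable_halfline (B : R) :
  (forall x : R, 0 <= x -> rint f x <= B) -> mu.-integrable `[0%R, +oo[ (EFin \o f).
Proof.
move=> HB; apply/integrableP; split.
  rewrite (itv_bndy_bigcup_BRight true 0).
  apply/measurable_fun_bigcup => // n.
  by have /integrableP[] : mu.-integrable `[0, 0 + n%:R] (EFin \o f)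
    by apply: If; rewrite add0r.
have -> : (\int[mu]_(t in `[0%R, +oo[) `|(EFin \o f) t| =
    \int[mu]_(t in `[0%R, +oo[) (f t)%:E)%E.
  apply: eq_integral => x; rewrite inE /= in_itv /= andbT => x0.
  by rewrite ger0_norm ?f0.
apply: (@le_lt_trans _ _ B%:E); last exact: ltry.
have H := cvg_integral_halfline.
rewrite -(cvg_lim _ H) //; apply: lime_le; first by apply/cvg_ex; eexists; exact: H.
by apply: nearW => n; rewrite lee_fin HB.
Qed.

Hypothesis If' : mu.-integrable `[0%R, +oo[ (EFin \o f).

Lemma rint_halfline_tail (e : R) : 0 < e -> exists2 X, 0 <= X &
  forall x : R, X <= x -> \int[mu]_(t in `[0, +oo[) f t - e < rint f x.
Proof.
move=> e0.
have H : rint f n%:R @[n --> \oo] --> \int[mu]_(t in `[0, +oo[) f t.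
  have := cvg_integral_halfline.
  rewrite -(fineK (integrable_fin_num _ If')) // => /fine_cvg.
  exact.
have /cvgrPdist_lt/(_ _ e0)[N _ HN] := H.
exists N%:R => // x Nx.
have := HN N (leqnn N) => /=; rewrite ltr_norml => /andP[_ HN'].
have : rint f N%:R <= rint f x by exact: rint_nd.
by move: HN'; set I := Rintegral _ _ _; move: I => I; lra.
Qed.

Lemma rint_le_halfline (x : R) : 0 <= x -> rint f x <= \int[mu]_(t in `[0, +oo[) f t.
Proof.
move=> x0; rewrite -subr_ge0 /rint Rintegral_itvB //.
apply: Rintegral_ge0 => t /=; rewrite in_itv /= andbT => xt.
by apply: f0; rewrite (le_trans x0) // ltW.
Qed.

End HalfLine.

(** * Tail of the potential, angle, radius and the normalised solution *)

Section Potential.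
Context {R : realType}.
Variable q : R -> R.
Hypothesis hq : L1_halfline q.
Implicit Types (x y t lam a b e : R).

Lemma lint_q : lint q.
Proof.
move=> x x0; apply: integrableS hq => //.
by apply: subset_itvl; rewrite bnd_simp.
Qed.

Definition qmass : R := \int[mu]_(t in `[0, +oo[) `|q t|.
Definition qabs : R -> R := rint (fun t => `|q t|).
(** This is the integral of [q] from [x] to infinity; writing it as a difference makes its
    continuity that of a primitive. *)
Definition qtail (x : R) : R := \int[mu]_(t in `[0, +oo[) q t - rint q x.

Lemma qmass_ge0 : 0 <= qmass.
Proof. exact: Rintegral_ge0. Qed.

Lemma qabs_ge0 x : 0 <= qabs x.
Proof. by apply: rint_ge0. Qed.

Lemma integrable_normq : mu.-integrable `[0%R, +oo[ (EFin \o (fun t => `|q t|)).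
Proof. exact: integrable_norm hq. Qed.

Lemma qabs_le x : 0 <= x -> qabs x <= qmass.
Proof.
by move=> x0; apply: rint_le_halfline => //; exact: integrable_normq.
Qed.

Lemma qabs_tail (e : R) : 0 < e ->
  exists2 X, 0 <= X & forall x, X <= x -> qmass - qabs x < e.
Proof.
move=> e0.
have [|X X0 HX] := rint_halfline_tail (lint_norm lint_q) _ integrable_normq e0.
  by [].
by exists X => // x /HX; rewrite -/qmass -/qabs; lra.
Qed.

Lemma qtail_le x : 0 <= x -> `|qtail x| <= qmass - qabs x.
Proof.
move=> x0; rewrite /qtail /qmass /qabs /rint.
have sub : `]x, +oo[ `<=` `[0, +oo[ by apply: subset_itvr; rewrite bnd_simp.
rewrite !Rintegral_itvB //; last exact: integrable_normq.
by apply: le_normr_Rintegral => //; apply: integrableS hq.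
Qed.

Lemma qtail_le_mass x : 0 <= x -> `|qtail x| <= qmass.
Proof.
by move=> x0; apply: (le_trans (qtail_le x0)); have := qabs_ge0 x; lra.
Qed.

Lemma cont_qtail : cont_ge0 qtail.
Proof. by apply: cont_ge0B; [exact: cont_ge0_cst|exact: cont_rint lint_q]. Qed.

(** From [tan th = u / v] one gets [th' = (u' v - u v') / r^2], and the linear system turns the
    numerator into [(v - c u)^2 + (lam - t) u^2]. At a zero of [u] the value is 1. *)
Definition angle_rhs (lam t a : R) : R :=
  (cos a - qtail t * sin a) ^+ 2 + (lam - t) * sin a ^+ 2.

Lemma sin_lip (a b : R) : `|sin a - sin b| <= `|a - b|.
Proof.
wlog ab : a b / a < b.
  move=> H; case: (ltgtP a b) => [/H//|/H|->]; last by rewrite !subrr.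
  by rewrite distrC (distrC b).
have [c _ E] := derive_mvt (F := sin) (f := cos) ab.
by rewrite distrC (distrC a) E normrM ler_piMl // ler_norml cos_geN1 cos_le1.
Qed.

Lemma cos_lip (a b : R) : `|cos a - cos b| <= `|a - b|.
Proof.
wlog ab : a b / a < b.
  move=> H; case: (ltgtP a b) => [/H//|/H|->]; last by rewrite !subrr.
  by rewrite distrC (distrC b).
have [c _ E] := derive_mvt (F := cos) (f := fun x => - sin x) ab.
by rewrite distrC (distrC a) E normrM ler_piMl // normrN ler_norml sin_geN1 sin_le1.
Qed.

Lemma norm_sin_le1 (a : R) : `|sin a| <= 1.
Proof. by rewrite ler_norml sin_geN1 sin_le1. Qed.

Lemma norm_cos_le1 (a : R) : `|cos a| <= 1.
Proof. by rewrite ler_norml cos_geN1 cos_le1. Qed.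

Lemma norm_lin_le1 t a : 0 <= t -> `|cos a - qtail t * sin a| <= 1 + qmass.
Proof.
move=> t0; apply: (le_trans (ler_normB _ _)); rewrite normrM.
apply: lerD; first exact: norm_cos_le1.
rewrite -[leRHS]mulr1; apply: ler_pM => //; [exact: qtail_le_mass|exact: norm_sin_le1].
Qed.

Lemma angle_rhs_lip lam t a b : 0 <= t ->
  `|angle_rhs lam t a - angle_rhs lam t b| <=
  (2 * (1 + qmass) ^+ 2 + `|lam| + t) * `|a - b|.
Proof.
move=> t0; rewrite /angle_rhs.
set X := cos a - _; set Y := cos b - _.
(* Factoring the difference of squares gives the Lipschitz constant [|lam| + t] without a factor 2,
   so that the total has the shape [L + t] required by [picard]. *)
have sqE : sin a ^+ 2 - sin b ^+ 2 = sin (a + b) * sin (a - b).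
  have ha : cos a ^+ 2 = 1 - sin a ^+ 2 by have := cos2Dsin2 a; lra.
  have hb : cos b ^+ 2 = 1 - sin b ^+ 2 by have := cos2Dsin2 b; lra.
  rewrite sinD sinB [RHS](_ : _ = sin a ^+ 2 * cos b ^+ 2 - cos a ^+ 2 * sin b ^+ 2).
    by rewrite ha hb; ring.
  by ring.
rewrite (_ : _ - _ = (X - Y) * (X + Y) + (lam - t) * (sin a ^+ 2 - sin b ^+ 2)); last by ring.
apply: (le_trans (ler_normD _ _)); rewrite -[X in X * `|a - b|]addrA [leRHS]mulrDl; apply: lerD.
  rewrite normrM.
  have HX : `|X| <= 1 + qmass := norm_lin_le1 a t0.
  have HY : `|Y| <= 1 + qmass := norm_lin_le1 b t0.
  have HXY : `|X + Y| <= 2 * (1 + qmass).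
    by apply: (le_trans (ler_normD _ _)); lra.
  have HD : `|X - Y| <= (1 + qmass) * `|a - b|.
    rewrite (_ : X - Y = (cos a - cos b) - qtail t * (sin a - sin b)); last first.
      by rewrite /X /Y; ring.
    apply: (le_trans (ler_normB _ _)); rewrite [leRHS]mulrDl mul1r normrM.
    apply: lerD; first exact: cos_lip.
    by apply: ler_pM => //; [exact: qtail_le_mass|exact: sin_lip].
  rewrite (_ : 2 * _ * _ = ((1 + qmass) * `|a - b|) * (2 * (1 + qmass))); last by ring.
  exact: ler_pM.
rewrite normrM sqE; apply: ler_pM => //.
  by apply: (le_trans (ler_normB _ _)); rewrite (ger0_norm t0).
rewrite normrM -[leRHS]mul1r; apply: ler_pM => //; first exact: norm_sin_le1.
by have := sin_lip (a - b) 0; rewrite sin0 !subr0.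
Qed.

Lemma cont_angle_rhs lam (y : R -> R) : cont_ge0 y -> cont_ge0 (fun t => angle_rhs lam t (y t)).
Proof.
move=> cy; have cc := cont_ge0_comp (@continuous_cos R) cy.
have cs := cont_ge0_comp (@continuous_sin R) cy.
apply: cont_ge0D.
  by apply: cont_ge0X; apply: cont_ge0B => //; apply: cont_ge0M => //; exact: cont_qtail.
apply: cont_ge0M; last exact: cont_ge0X.
by apply: cont_ge0B; [exact: cont_ge0_cst|exact: cont_ge0_id].
Qed.

(* [cot theta0 = qtail 0] encodes the Neumann condition [u'(0) = 0] for the
   quasi-derivative [v = u' + qtail * u]. *)
Definition theta0 : R := pi / 2 - atan (qtail 0).

Lemma theta_exists lam : exists2 y : R -> R, y 0 = theta0 &
  forall x : R, 0 <= x -> is_derive x 1 y (angle_rhs lam x (y x)).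
Proof.
apply: (@picard _ _ (2 * (1 + qmass) ^+ 2 + `|lam|) 1).
- by rewrite addr_ge0 // mulr_ge0 // exprn_ge0 // addr_ge0 // qmass_ge0.
- by move=> y; exact: cont_angle_rhs.
- by move=> t a b t0; exact: angle_rhs_lip.
move=> t t0; rewrite mulr1 /angle_rhs; apply: (le_trans (ler_normD _ _)).
rewrite -addrA; apply: lerD.
  rewrite normrX.
  have : `|cos theta0 - qtail t * sin theta0| ^+ 2 <= (1 + qmass) ^+ 2.
    by rewrite lerXn2r ?nnegrE //; [rewrite addr_ge0 ?qmass_ge0|exact: norm_lin_le1].
  by have := sqr_ge0 (1 + qmass); lra.
rewrite normrM -[leRHS]mulr1; apply: ler_pM => //.
  by apply: (le_trans (ler_normB _ _)); rewrite (ger0_norm t0).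
by rewrite normrX expr_le1 //; exact: norm_sin_le1.
Qed.

Definition theta lam : R -> R := s2val (cid2 (theta_exists lam)).

Lemma theta_0 lam : theta lam 0 = theta0.
Proof. exact: s2valP (cid2 (theta_exists lam)). Qed.

Lemma theta_derive lam x : 0 <= x ->
  is_derive x 1 (theta lam) (angle_rhs lam x (theta lam x)).
Proof. exact: s2valP' (cid2 (theta_exists lam)) x. Qed.

Lemma cont_theta lam : cont_ge0 (theta lam).
Proof. by move=> x x0; exact: is_derive_continuous (theta_derive lam x0). Qed.

(** This is [(u u' + v v') / r^2], the logarithmic derivative of the radius. Once the angle is known
    it is an explicit function, so the radius is an exponential and never vanishes; division by
    [sin theta0] in [amplitude] normalises [u 0 = 1]. *)
Definition amplitude_rate lam t : R :=
  let C := cos (theta lam t) in let S := sin (theta lam t) in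
  (C - qtail t * S) * S + ((t - lam - qtail t ^+ 2) * S + qtail t * C) * C.

Definition amplitude lam x : R := expR (prim (amplitude_rate lam) x) / sin theta0.

Definition sol lam x : R := amplitude lam x * sin (theta lam x).
Definition qsol lam x : R := amplitude lam x * cos (theta lam x).

Lemma sin_theta0_gt0 : 0 < sin theta0.
Proof.
rewrite /theta0 sinB sin_pihalf cos_pihalf mul1r mul0r subr0.
by apply: cos_gt0_pihalf; rewrite atan_gtNpi2 atan_ltpi2.
Qed.

Lemma theta0_gt0 : 0 < theta0.
Proof. by have := atan_ltpi2 (qtail 0); rewrite /theta0; lra. Qed.

Lemma theta0_lt : theta0 < pi.
Proof. by have := atan_gtNpi2 (qtail 0); rewrite /theta0; lra. Qed.

Lemma amplitude_gt0 lam x : 0 < amplitude lam x.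
Proof. by rewrite divr_gt0 ?expR_gt0 ?sin_theta0_gt0. Qed.

Lemma cont_amplitude_rate lam : cont_ge0 (amplitude_rate lam).
Proof.
have cc := cont_ge0_comp (@continuous_cos R) (cont_theta (lam := lam)).
have cs := cont_ge0_comp (@continuous_sin R) (cont_theta (lam := lam)).
have cq := cont_qtail.
apply: cont_ge0D.
  by apply: cont_ge0M => //; apply: cont_ge0B => //; apply: cont_ge0M.
apply: cont_ge0M => //; apply: cont_ge0D; last exact: cont_ge0M.
apply: cont_ge0M => //; apply: cont_ge0B; last exact: cont_ge0X.
by apply: cont_ge0B; [exact: cont_ge0_id|exact: cont_ge0_cst].
Qed.

Lemma amplitude_derive lam x : 0 <= x ->
  is_derive x 1 (amplitude lam) (amplitude lam x * amplitude_rate lam x).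
Proof.
move=> x0; have dp := prim_derive (cont_amplitude_rate (lam := lam)) x0.
have d2 : is_derive x 1 (fun x => expR (prim (amplitude_rate lam) x))
   (expR (prim (amplitude_rate lam) x) * amplitude_rate lam x).
  exact: (@is_derive1_comp _ expR).
rewrite /amplitude; apply: is_derive_eq.
by rewrite /GRing.scale /=; ring.
Qed.

Lemma sol_derive lam x : 0 <= x ->
  is_derive x 1 (sol lam) (qsol lam x - qtail x * sol lam x).
Proof.
move=> x0; have d1 := theta_derive lam x0; have d2 := amplitude_derive lam x0.
have d3 : is_derive x 1 (fun x => sin (theta lam x))
    (cos (theta lam x) * angle_rhs lam x (theta lam x)).
  exact: (@is_derive1_comp _ sin).
rewrite /sol /qsol; apply: is_derive_eq; rewrite /GRing.scale /=.
rewrite /amplitude_rate /angle_rhs.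
set C := cos _; set S := sin _.
rewrite [LHS](_ : _ = (amplitude lam x * C - qtail x * (amplitude lam x * S)) * (C ^+ 2 + S ^+ 2)).
  by rewrite cos2Dsin2 mulr1.
by ring.
Qed.

Lemma qsol_derive lam x : 0 <= x ->
  is_derive x 1 (qsol lam)
    ((x - lam - qtail x ^+ 2) * sol lam x + qtail x * qsol lam x).
Proof.
move=> x0; have d1 := theta_derive lam x0; have d2 := amplitude_derive lam x0.
have d3 : is_derive x 1 (fun x => cos (theta lam x))
    (- sin (theta lam x) * angle_rhs lam x (theta lam x)).
  exact: (@is_derive1_comp _ cos).
rewrite /sol /qsol; apply: is_derive_eq; rewrite /GRing.scale /=.
rewrite /amplitude_rate /angle_rhs.
set C := cos _; set S := sin _.
rewrite [LHS](_ : _ = ((x - lam - qtail x ^+ 2) * (amplitude lam x * S) +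
   qtail x * (amplitude lam x * C)) * (C ^+ 2 + S ^+ 2)).
  by rewrite cos2Dsin2 mulr1.
by ring.
Qed.

Lemma sol_0 lam : sol lam 0 = 1.
Proof.
rewrite /sol theta_0 /amplitude prim_rint //; last exact: cont_amplitude_rate.
by rewrite rint0 expR0 mul1r mulVf // gt_eqF // sin_theta0_gt0.
Qed.

Lemma qsol_0 lam : qsol lam 0 = qtail 0.
Proof.
rewrite /qsol theta_0 /amplitude prim_rint //; last exact: cont_amplitude_rate.
rewrite rint0 expR0 mul1r mulrC /theta0 cosB sinB sin_pihalf cos_pihalf.
rewrite !mul1r !mul0r subr0 add0r -[RHS]atanK /tan.
by [].
Qed.

Lemma cont_sol lam : cont_ge0 (sol lam).
Proof. by move=> x x0; exact: is_derive_continuous (sol_derive lam x0). Qed.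

Lemma cont_qsol lam : cont_ge0 (qsol lam).
Proof. by move=> x x0; exact: is_derive_continuous (qsol_derive lam x0). Qed.

End Potential.

(** * Eigenfunctions and the regularised system *)

Lemma gronwall (R : realType) (G g : R -> R) (K a b : R) : a <= b ->
  (forall x, a <= x <= b -> is_derive x 1 G (g x)) ->
  (forall x, a <= x <= b -> g x <= K * G x) ->
  G b <= G a * expR (K * (b - a)).
Proof.
move=> ab dG HG.
have de (x : R) : is_derive x 1 (fun x => expR (- (K * (x - a)))) (expR (- (K * (x - a))) * - K).
  apply: (@is_derive1_comp _ expR); apply: is_derive_eq.
  by rewrite /GRing.scale /=; ring.
have : - (G a * expR (- (K * (a - a)))) <= - (G b * expR (- (K * (b - a)))).
  apply: (derive_ge0_le (F := fun x => - (G x * expR (- (K * (x - a)))))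
     (f := fun x => (K * G x - g x) * expR (- (K * (x - a))))) => // x xab.
    have := dG x xab => ?; have := de x => ?.
    by apply: is_derive_eq; rewrite /GRing.scale /=; ring.
  by rewrite mulr_ge0 ?expR_ge0 // subr_ge0 HG.
rewrite subrr mulr0 oppr0 expR0 mulr1 lerN2 => H.
by rewrite -ler_pdivrMr ?expR_gt0 // -expRN.
Qed.

Section Eigen.
Context {R : realType}.
Variable q : R -> R.
Hypothesis hq : L1_halfline q.
Implicit Types (x y t lam a b e : R).

Notation u lam := (sol hq lam).
Notation v lam := (qsol hq lam).
Notation c := (qtail q).

(* Integration by parts against [q], whose primitive is [- qtail]. *)
Lemma qtail_mul a (p : R -> R) x : lint p -> 0 <= x ->
  c x * (a + rint p x) = c 0 * a +
    rint (fun t => - q t * (a + rint p t) + p t * c t) x.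
Proof.
move=> Ip x0; have Iq := lint_q hq.
have cE y : 0 <= y -> c y = c 0 + rint (fun t => - q t) y.
  move=> y0; rewrite /qtail rint0 subr0.
  under [X in _ = _ + X]eq_rint do rewrite -mulN1r.
  by rewrite rintZ // mulN1r.
rewrite cE // rint_prod //; last exact: lintN.
congr (_ + _); apply: eq_rint => t t0.
by rewrite -(cE t t0).
Qed.

(** The classical derivative [u'], recovered from the quasi-derivative. *)
Definition dsol lam x := v lam x - c x * u lam x.

Lemma cont_dsol lam : cont_ge0 (dsol lam).
Proof.
apply: cont_ge0B; first exact: cont_qsol.
by apply: cont_ge0M; [exact: (cont_qtail hq)|exact: cont_sol].
Qed.

Lemma dsol_0 lam : dsol lam 0 = 0.
Proof. by rewrite /dsol qsol_0 sol_0 mulr1 subrr. Qed.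

Lemma lint_potential lam (w : R -> R) : cont_ge0 w -> lint (fun t => (t + q t - lam) * w t).
Proof.
move=> cw; apply: lintM => //; apply: lintD; last first.
  by apply: cont_ge0_lint; exact: cont_ge0_cst.
by apply: lintD; [apply: cont_ge0_lint; exact: cont_ge0_id|exact: lint_q].
Qed.

Lemma rint_dsol lam x : 0 <= x -> rint (dsol lam) x = u lam x - 1.
Proof.
move=> x0; rewrite -(sol_0 hq lam); apply: derive_rint => //; first exact: cont_dsol.
by move=> y; exact: sol_derive.
Qed.

(** Back from the regularised system to the original equation: integrating [c u] by parts releases
    the term [q u], and the terms in [c] cancel against those in the equation for [v]. *)
Lemma dsolE lam x : 0 <= x ->
  dsol lam x = rint (fun t => (t + q t - lam) * u lam t) x.
Proof.
move=> x0.
have cu := cont_sol (hq := hq) (lam := lam); have cv := cont_qsol (hq := hq) (lam := lam).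
have cc := cont_qtail hq.
have Ip := cont_ge0_lint (cont_dsol (lam := lam)).
have uE y : 0 <= y -> u lam y = 1 + rint (dsol lam) y.
  by move=> y0; rewrite rint_dsol //; ring.
have cw : cont_ge0 (fun t => (t - lam - c t ^+ 2) * u lam t + c t * v lam t).
  apply: cont_ge0D; last exact: cont_ge0M.
  apply: cont_ge0M => //; apply: cont_ge0B; last exact: cont_ge0X.
  by apply: cont_ge0B; [exact: cont_ge0_id|exact: cont_ge0_cst].
have vE : v lam x = c 0 + rint (fun t => (t - lam - c t ^+ 2) * u lam t + c t * v lam t) x.
  by rewrite (derive_rint cw (qsol_derive hq lam) x0) qsol_0; ring.
have I1 : lint (fun t => - q t * u lam t + dsol lam t * c t).
  apply: lintD; first by apply: lintM => //; apply: lintN; exact: lint_q.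
  exact: lintM.
rewrite [LHS]/dsol vE uE // qtail_mul // mulr1.
rewrite opprD addrACA subrr add0r.
rewrite (_ : rint (fun t => - q t * (1 + _) + _) x =
             rint (fun t => - q t * u lam t + dsol lam t * c t) x); last first.
  by apply: eq_rint => t t0; rewrite -uE.
rewrite -rintB //; last exact: cont_ge0_lint.
by apply: eq_rint => t t0; rewrite /dsol; ring.
Qed.

Lemma sol_eigenfunction lam :
  mu.-integrable `[0%R, +oo[ (fun x => (u lam x ^+ 2)%:E) ->
  neumann_eigenfunction q lam (u lam).
Proof.
move=> I2; split => //; first by exists 0; rewrite lexx sol_0 oner_eq0.
exists (dsol lam); split => [|x x0]; first exact: dsol_0.
split.
- exact: cont_ge0_lint (cont_dsol (lam := lam)) x x0.
- exact: lint_potential (cont_sol (hq := hq) (lam := lam)) x x0.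
- by have := rint_dsol lam x0; rewrite /rint sol_0 => ->; ring.
- by rewrite dsol_0 add0r; exact: dsolE.
Qed.

Lemma linear_system_uniq lam (y z : R -> R) b : 0 <= b ->
  (forall x, 0 <= x -> is_derive x 1 y (z x - c x * y x)) ->
  (forall x, 0 <= x -> is_derive x 1 z ((x - lam - c x ^+ 2) * y x + c x * z x)) ->
  y 0 = 0 -> z 0 = 0 -> y b = 0.
Proof.
move=> b0 dy dz y0 z0.
pose J := qmass q.
(* The derivative of [y^2 + z^2] is [2 y z (1 + x - lam - c^2) - 2 c y^2 + 2 c z^2]. The first four
   summands of [K] bound the coefficient of [2 y z], and [2 J] bounds the diagonal terms. *)
pose K := 1 + b + `|lam| + J ^+ 2 + 2 * J.
have : y b ^+ 2 + z b ^+ 2 <= (y 0 ^+ 2 + z 0 ^+ 2) * expR (K * (b - 0)).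
  apply: (gronwall (G := fun x => y x ^+ 2 + z x ^+ 2)
    (g := fun x => 2 * y x * (z x - c x * y x) +
       2 * z x * ((x - lam - c x ^+ 2) * y x + c x * z x))) => // x /andP[x0 xb].
    have := dy x x0 => ?; have := dz x x0 => ?.
    by apply: is_derive_eq; rewrite /GRing.scale /=; ring.
  have cJ : `|c x| <= J by exact: (qtail_le_mass hq).
  have c2J : c x ^+ 2 <= J ^+ 2.
    by rewrite -real_normK ?num_real // lerXn2r ?nnegrE // (le_trans _ cJ).
  have lamb := ler_norm lam; have lamb' := ler_norm (- lam); rewrite normrN in lamb'.
  have [yz0|yz0] := leP 0 (y x * z x).
  - have h : 2 * (y x * z x) <= y x ^+ 2 + z x ^+ 2 by have := sqr_ge0 (y x - z x); lra.
    move: cJ; rewrite ler_norml => /andP[c1 c2].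
    have h2 : 2 * (y x * z x) * (1 + x - lam - c x ^+ 2) <=
       (y x ^+ 2 + z x ^+ 2) * (1 + b + `|lam| + J ^+ 2).
      apply: (@le_trans _ _ (2 * (y x * z x) * (1 + b + `|lam| + J ^+ 2))).
        rewrite ler_wpM2l //; first by lra.
        by have := sqr_ge0 (c x); have := sqr_ge0 J; lra.
      by rewrite ler_wpM2r //; have := sqr_ge0 J; have := normr_ge0 lam; lra.
    have := sqr_ge0 (y x); have := sqr_ge0 (z x) => hz hy.
    have h3 : - (c x * y x ^+ 2) <= J * y x ^+ 2 by nra.
    have h4 : c x * z x ^+ 2 <= J * z x ^+ 2 by nra.
    rewrite /K; lra.
  - have h : - (2 * (y x * z x)) <= y x ^+ 2 + z x ^+ 2 by have := sqr_ge0 (y x + z x); lra.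
    move: cJ; rewrite ler_norml => /andP[c1 c2].
    have h2 : - (2 * (y x * z x)) * (- (1 + x - lam - c x ^+ 2)) <=
       (y x ^+ 2 + z x ^+ 2) * (1 + b + `|lam| + J ^+ 2).
      apply: (@le_trans _ _ (- (2 * (y x * z x)) * (1 + b + `|lam| + J ^+ 2))).
        rewrite ler_wpM2l //; first by lra.
        by have := sqr_ge0 (c x); have := sqr_ge0 J; lra.
      by rewrite ler_wpM2r //; have := sqr_ge0 J; have := normr_ge0 lam; lra.
    have := sqr_ge0 (y x); have := sqr_ge0 (z x) => hz hy.
    have h3 : - (c x * y x ^+ 2) <= J * y x ^+ 2 by nra.
    have h4 : c x * z x ^+ 2 <= J * z x ^+ 2 by nra.
    rewrite /K; lra.
rewrite y0 z0 expr0n addr0 mul0r => H.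
apply/eqP; rewrite -sqrf_eq0; apply/eqP/le_anti.
by rewrite sqr_ge0 andbT; have := sqr_ge0 (z b); lra.
Qed.

(** An eigenfunction satisfies integral identities only. It is replaced by the differentiable [F],
    which agrees with it on the half-line, and by its quasi-derivative [V]; [qtail_mul] cancels the
    term with [q] in [V]. The pair solves the linear system, and uniqueness is applied to its
    difference with [phi 0] times the normalised solution. *)
Lemma eigenfunction_sol lam (phi : R -> R) : neumann_eigenfunction q lam phi ->
  forall x, 0 <= x -> phi x = phi 0 * u lam x.
Proof.
move=> [_ _ [psi [psi0 H]]].
have Ipsi : lint psi by move=> x x0; case: (H x x0).
have IV : lint (fun t => (t + q t - lam) * phi t) by move=> x x0; case: (H x x0).
have psiE x : 0 <= x -> psi x = rint (fun t => (t + q t - lam) * phi t) x.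
  by move=> x0; case: (H x x0) => _ _ _ ->; rewrite psi0 add0r.
pose P := rint (fun t => (t + q t - lam) * phi t).
have cP : cont_ge0 P by exact: cont_rint.
have IP := cont_ge0_lint cP.
have phiE x : 0 <= x -> phi x = phi 0 + rint P x.
  move=> x0; case: (H x x0) => _ _ {1}-> _; congr (_ + _).
  by apply: eq_rint => t t0; exact: psiE.
pose F x := phi 0 + prim P x.
have FE x : 0 <= x -> F x = phi x by move=> x0; rewrite phiE // /F prim_rint.
have dF x : 0 <= x -> is_derive x 1 F (P x).
  move=> x0; have dp := prim_derive cP x0; rewrite /F.
  by apply: is_derive_eq; rewrite add0r ?mul1r.
have cF : cont_ge0 F by move=> x x0; exact: is_derive_continuous (dF x x0).
have cc := cont_qtail hq.
pose w t := (t - lam) * F t + c t * P t.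
have cw : cont_ge0 w.
  apply: cont_ge0D; last exact: cont_ge0M.
  by apply: cont_ge0M => //; apply: cont_ge0B; [exact: cont_ge0_id|exact: cont_ge0_cst].
pose V x := c 0 * phi 0 + prim w x.
have VE x : 0 <= x -> V x = P x + c x * F x.
  move=> x0; rewrite /V prim_rint // FE // (phiE x x0) qtail_mul // addrCA; congr (_ + _).
  rewrite /P -rintD //; last first.
    apply: lintD; last exact: lintM.
    apply: lintM; first exact: lintN (lint_q hq).
    by apply: cont_ge0D; [exact: cont_ge0_cst|exact: cont_rint].
  apply: eq_rint => t t0; rewrite -/P -phiE // /w FE //; ring.
have dV x : 0 <= x -> is_derive x 1 V (w x).
  move=> x0; have dp := prim_derive cw x0; rewrite /V.
  by apply: is_derive_eq; rewrite add0r ?mul1r.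
move=> x x0; rewrite -FE //; apply/eqP; rewrite -subr_eq0; apply/eqP.
have U := @linear_system_uniq lam (fun x => F x - phi 0 * u lam x)
   (fun x => V x - phi 0 * v lam x) x x0.
apply: U => [y y0|y y0||].
- have := dF y y0 => ?; have := sol_derive hq lam y0 => ?.
  by apply: is_derive_eq; rewrite VE // /GRing.scale /=; ring.
- have := dV y y0 => ?; have := qsol_derive hq lam y0 => ?.
  by apply: is_derive_eq; rewrite VE // /w /GRing.scale /=; ring.
- by rewrite FE // sol_0; ring.
- by rewrite /V prim_rint // rint0 qsol_0; ring.
Qed.

Lemma eigenfunction_neq0 lam (phi : R -> R) : neumann_eigenfunction q lam phi ->
  phi 0 != 0.
Proof.
move=> H; have [[x [x0 px]] _ _] := H.
by apply: contra px => /eqP p0; rewrite (eigenfunction_sol H x0) p0 mul0r.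
Qed.

Lemma eigenfunction_integrable lam (phi : R -> R) : neumann_eigenfunction q lam phi ->
  mu.-integrable `[0%R, +oo[ (fun x => (u lam x ^+ 2)%:E).
Proof.
move=> H; have [_ I2 _] := H; have p0 := eigenfunction_neq0 H.
apply: (eq_integrable _ _ _ _ (integrableZl _ (phi 0 ^- 2) I2)) => // x.
rewrite inE /= in_itv /= andbT => x0.
by rewrite -EFinM (eigenfunction_sol H x0) exprMn mulKf // expf_neq0.
Qed.

Lemma neumann_eigenvalueP lam : neumann_eigenvalue q lam <->
  mu.-integrable `[0%R, +oo[ (fun x => (u lam x ^+ 2)%:E).
Proof.
split=> [[phi H]|H]; first exact: eigenfunction_integrable H.
by exists (u lam); exact: sol_eigenfunction.
Qed.

Lemma inv_norming_sol lam (phi : R -> R) : neumann_eigenfunction q lam phi ->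
  inv_norming phi = \int[mu]_(x in `[0, +oo[) u lam x ^+ 2.
Proof.
move=> H; have p0 := eigenfunction_neq0 H.
rewrite /inv_norming (_ : Rintegral _ _ _ =
   \int[mu]_(x in `[0, +oo[) (phi 0 ^+ 2 * u lam x ^+ 2)); last first.
  apply: eq_Rintegral => x; rewrite inE /= in_itv /= andbT => x0.
  by rewrite (eigenfunction_sol H x0) exprMn.
rewrite RintegralZl //; last exact: eigenfunction_integrable H.
by rewrite mulrC mulKf // expf_neq0.
Qed.

End Eigen.

(** * Dichotomy beyond the turning point *)

Section Dichotomy.
Context {R : realType}.
Variable q : R -> R.
Hypothesis hq : L1_halfline q.
Implicit Types (x y t lam a b e : R).

Notation u lam := (sol hq lam).
Notation v lam := (qsol hq lam).
Notation c := (qtail q).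

Lemma sol_qsol_neq0 lam x : 0 < u lam x ^+ 2 + v lam x ^+ 2.
Proof.
rewrite /sol /qsol; have := amplitude_gt0 hq lam x; move: (amplitude _ _ _) => r r0.
rewrite !exprMn -mulrDr addrC cos2Dsin2 mulr1.
by rewrite exprn_gt0.
Qed.

Definition sqint lam : R -> R := prim (fun t => u lam t ^+ 2).

Lemma cont_sol2 lam : cont_ge0 (fun t => u lam t ^+ 2).
Proof. by apply: cont_ge0X; exact: cont_sol. Qed.

Lemma sqint_derive lam x : 0 <= x -> is_derive x 1 (sqint lam) (u lam x ^+ 2).
Proof. by move=> x0; exact: prim_derive (cont_sol2 (lam := lam)) x0. Qed.

Lemma sqintE lam x : 0 <= x -> sqint lam x = rint (fun t => u lam t ^+ 2) x.
Proof. by move=> x0; apply: prim_rint => //; exact: cont_sol2. Qed.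

Lemma sqint_nd lam x y : 0 <= x -> x <= y -> sqint lam x <= sqint lam y.
Proof.
move=> x0 xy; apply: (derive_ge0_le (f := fun t => u lam t ^+ 2)) => // t /andP[xt _].
  by apply: sqint_derive; exact: le_trans xt.
exact: sqr_ge0.
Qed.

Lemma sqint_0 lam : sqint lam 0 = 0.
Proof. by rewrite sqintE // rint0. Qed.

Lemma sqint_ge0 lam x : 0 <= x -> 0 <= sqint lam x.
Proof. by move=> x0; rewrite -(sqint_0 lam) sqint_nd. Qed.

Definition flux lam x := u lam x * (u lam x + v lam x).

Lemma flux_derive lam x : 0 <= x -> is_derive x 1 (flux lam)
  ((u lam x + v lam x) ^+ 2 + (x - lam - c x ^+ 2 - 2 * c x - 1) * u lam x ^+ 2).
Proof.
move=> x0; have := sol_derive hq lam x0 => ?; have := qsol_derive hq lam x0 => ?.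
by rewrite /flux; apply: is_derive_eq; rewrite /GRing.scale /=; ring.
Qed.

Definition prodsol lam x := u lam x * v lam x.

Lemma prodsol_derive lam x : 0 <= x -> is_derive x 1 (prodsol lam)
  (v lam x ^+ 2 + (x - lam - c x ^+ 2) * u lam x ^+ 2).
Proof.
move=> x0; have := sol_derive hq lam x0 => ?; have := qsol_derive hq lam x0 => ?.
by rewrite /prodsol; apply: is_derive_eq; rewrite /GRing.scale /=; ring.
Qed.

Variable X : R.
Hypothesis X0 : 0 <= X.
Hypothesis HX : forall x, X <= x -> `|c x| <= 1 / 2.

(** The classically forbidden region. With [|c| <= 1 / 2] the margin 3 leaves at least
    [3 - 1/4 - 1 - 1 = 3/4] for the coefficient of [u^2] in the derivative of [flux]. *)
Definition forbidden lam x := (X <= x) && (lam + 3 <= x).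

Lemma forbidden_ge0 lam x : forbidden lam x -> 0 <= x.
Proof. by move=> /andP[Xx _]; exact: le_trans Xx. Qed.

Lemma forbidden_le lam x y : forbidden lam x -> x <= y -> forbidden lam y.
Proof. by move=> /andP[? ?] ?; apply/andP; split; lra. Qed.

Lemma forbidden_c lam x : forbidden lam x ->
  [/\ - (1 / 2) <= c x, c x <= 1 / 2 & c x ^+ 2 <= 1 / 4].
Proof. by move=> /andP[/HX]; rewrite ler_norml => /andP[h1 h2] _; split=> //; nra. Qed.

Lemma flux_rate_ge lam x : forbidden lam x ->
  (u lam x + v lam x) ^+ 2 + 3 / 4 * u lam x ^+ 2 <=
  (u lam x + v lam x) ^+ 2 + (x - lam - c x ^+ 2 - 2 * c x - 1) * u lam x ^+ 2.
Proof.
move=> fx; have [h1 h2 h3] := forbidden_c fx; have /andP[_ xl] := fx.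
by rewrite lerD2l ler_wpM2r ?sqr_ge0 //; lra.
Qed.

Lemma flux_incr lam a b : forbidden lam a -> a < b -> flux lam a < flux lam b.
Proof.
move=> fa ab; apply: (derive_gt0_lt ab) => [x /andP[ax _]|x /andP[/ltW ax _]].
  by apply: flux_derive; exact: forbidden_ge0 (forbidden_le fa ax).
apply: lt_le_trans (flux_rate_ge (forbidden_le fa ax)).
have := sol_qsol_neq0 lam x.
have [->|u0] := eqVneq (u lam x) 0; first by rewrite expr0n !add0r mulr0 addr0.
have : 0 < u lam x ^+ 2 by rewrite exprn_even_gt0.
by have := sqr_ge0 (u lam x + v lam x); lra.
Qed.

(** A limit-free form of the eigenvalue condition; [eigenvalue_decays] proves the equivalence. *)
Definition decays lam := forall x, forbidden lam x -> flux lam x < 0.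

Lemma decays_sqint lam a b : decays lam -> forbidden lam a -> a <= b ->
  sqint lam b <= sqint lam a - 4 / 3 * flux lam a.
Proof.
move=> Hd fa ab.
have : flux lam a - 3 / 4 * sqint lam a <= flux lam b - 3 / 4 * sqint lam b.
  apply: (derive_ge0_le (F := fun x => flux lam x - 3 / 4 * sqint lam x)
    (f := fun x => (u lam x + v lam x) ^+ 2 + (x - lam - c x ^+ 2 - 2 * c x - 1) * u lam x ^+ 2
      - 3 / 4 * u lam x ^+ 2)) => // x /andP[ax _].
    have x0 := forbidden_ge0 (forbidden_le fa ax).
    have := flux_derive lam x0 => ?; have := sqint_derive lam x0 => ?.
    by apply: is_derive_eq; rewrite /GRing.scale /=; ring.
  by have := flux_rate_ge (forbidden_le fa ax); have := sqr_ge0 (u lam x + v lam x); lra.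
by have := Hd b (forbidden_le fa ab); lra.
Qed.

Lemma exists_forbidden lam e : exists2 b, forbidden lam b & e <= b.
Proof.
exists (Num.max e (Num.max X (lam + 3))); last by rewrite le_max lexx.
by rewrite /forbidden !le_max !lexx !orbT.
Qed.

Lemma decays_integrable lam : decays lam ->
  mu.-integrable `[0%R, +oo[ (fun x => (u lam x ^+ 2)%:E).
Proof.
move=> Hd; have [b fb _] := exists_forbidden lam 0.
apply: (@integrable_halfline _ (fun x => u lam x ^+ 2) _ _
   (sqint lam b - 4 / 3 * flux lam b)).
- exact: cont_ge0_lint (cont_sol2 (lam := lam)).
- by move=> t _; exact: sqr_ge0.
move=> x x0; rewrite -sqintE //.
have [bx|/ltW xb] := leP b x; first exact: decays_sqint.
by apply: (le_trans (sqint_nd lam x0 xb)); have := Hd b fb; lra.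
Qed.

Lemma integrable_sqint lam x :
  mu.-integrable `[0%R, +oo[ (fun x => (u lam x ^+ 2)%:E) -> 0 <= x ->
  sqint lam x <= \int[mu]_(t in `[0, +oo[) u lam t ^+ 2.
Proof.
move=> I2 x0; rewrite sqintE //; apply: rint_le_halfline => // t _; exact: sqr_ge0.
Qed.

(** Once [flux] is nonnegative it stays above a constant [p > 0]. Then [u^2] plus three times its
    primitive grows at rate at least [2 p]; as the primitive is bounded by [N], [u^2] itself must
    grow, contradicting integrability. *)
Lemma integrable_decays lam :
  mu.-integrable `[0%R, +oo[ (fun x => (u lam x ^+ 2)%:E) -> decays lam.
Proof.
move=> I2 x fx; rewrite ltNge; apply/negP => P0.
set N := \int[mu]_(t in `[0, +oo[) u lam t ^+ 2.
have HN y : 0 <= y -> sqint lam y <= N by move=> y0; exact: integrable_sqint.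
have x1 : x < x + 1 by rewrite ltrDl.
set a := x + 1 in x1.
have fa : forbidden lam a := forbidden_le fx (ltW x1).
have P1 : 0 < flux lam a := le_lt_trans P0 (flux_incr fx x1).
set p := flux lam a in P1.
have Pge y : a <= y -> p <= flux lam y.
  by rewrite le_eqVlt => /predU1P[<-//|ay]; exact: ltW (flux_incr fa ay).
(* The derivative is [2 (flux - p) + (1 - 2 c) u^2], which is nonnegative because [c <= 1 / 2]; this
   is why the primitive is weighted by 3. *)
have T y : a <= y -> u lam a ^+ 2 + 3 * sqint lam a - 2 * p * a <=
    u lam y ^+ 2 + 3 * sqint lam y - 2 * p * y.
  move=> ay; apply: (derive_ge0_le (F := fun y => u lam y ^+ 2 + 3 * sqint lam y - 2 * p * y)
    (f := fun y => 2 * u lam y * (v lam y - c y * u lam y) + 3 * u lam y ^+ 2 - 2 * p)) => //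
    z /andP[az _]; have fz := forbidden_le fa az.
    have z0 := forbidden_ge0 fz.
    have := sol_derive hq lam z0 => ?; have := sqint_derive lam z0 => ?.
    by apply: is_derive_eq; rewrite /GRing.scale /=; ring.
  have [_ c2 _] := forbidden_c fz; have := Pge z az; rewrite /flux => h.
  have : 0 <= (1 - 2 * c z) * u lam z ^+ 2 by rewrite mulr_ge0 ?sqr_ge0 //; lra.
  lra.
have a0 := forbidden_ge0 fa.
(* Past [Y] the linear growth exceeds [1 + 3 N], whence [u^2 >= 1]; over a further length [N + 1]
   the primitive would exceed [N]. *)
pose Y := a + (1 + 3 * N + 2 * p * a) / (2 * p).
have N0 : 0 <= N by apply: Rintegral_ge0 => t _; exact: sqr_ge0.
have aY : a <= Y.
  have := mulr_ge0 (ltW P1) a0 => pa.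
  by rewrite lerDl; apply: divr_ge0; lra.
have Hu y : Y <= y -> 1 <= u lam y ^+ 2.
  move=> Yy; have ay := le_trans aY Yy; have := T y ay.
  have := HN y (le_trans a0 ay); have := sqint_ge0 lam a0; have := sqr_ge0 (u lam a).
  have : 2 * p * Y <= 2 * p * y by rewrite ler_wpM2l //; lra.
  have -> : 2 * p * Y = 2 * p * a + (1 + 3 * N + 2 * p * a).
    by rewrite /Y; field; rewrite gt_eqF.
  have : 0 <= p * a by rewrite mulr_ge0 // ltW.
  lra.
have Y0 := le_trans a0 aY.
have YN : Y <= Y + (N + 1) by lra.
have : sqint lam Y - Y <= sqint lam (Y + (N + 1)) - (Y + (N + 1)).
  apply: (derive_ge0_le (F := fun y => sqint lam y - y) (f := fun y => u lam y ^+ 2 - 1)) => //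
    z /andP[Yz _].
    have := sqint_derive lam (le_trans Y0 Yz) => ?.
    by apply: is_derive_eq.
  by rewrite subr_ge0 Hu.
by have := HN _ (le_trans Y0 YN); have := sqint_ge0 lam Y0; lra.
Qed.

Lemma eigenvalue_decays lam : neumann_eigenvalue q lam <-> decays lam.
Proof.
rewrite (neumann_eigenvalueP hq); by split; [exact: integrable_decays|exact: decays_integrable].
Qed.

Lemma decays_prodsol lam x : decays lam -> forbidden lam x -> prodsol lam x <= 0.
Proof.
move=> Hd fx; have := Hd x fx; rewrite /flux /prodsol.
by have := sqr_ge0 (u lam x); lra.
Qed.

(** In the forbidden region this dominates [u^2 + v^2], hence Wronskians, and the weight [x - lam]
    makes it control the energy as well. *)
Definition tailnorm lam x := v lam x ^+ 2 + (x - lam) * u lam x ^+ 2.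

Lemma prodsol_rate_ge lam x : forbidden lam x ->
  1 / 2 * tailnorm lam x <= v lam x ^+ 2 + (x - lam - c x ^+ 2) * u lam x ^+ 2.
Proof.
move=> fx; have [_ _ h3] := forbidden_c fx; have /andP[_ xl] := fx; rewrite /tailnorm.
have : 0 <= ((x - lam) / 2 - c x ^+ 2) * u lam x ^+ 2 by rewrite mulr_ge0 ?sqr_ge0 //; lra.
by have := sqr_ge0 (v lam x); lra.
Qed.

(* [u v] is negative with derivative at least [tailnorm / 2], so the latter
   cannot stay bounded away from zero. *)
Lemma tailnorm_small lam1 lam2 e b : decays lam1 -> decays lam2 -> 0 < e ->
  exists x, [/\ b <= x, forbidden lam1 x, forbidden lam2 x &
    tailnorm lam1 x + tailnorm lam2 x <= e].
Proof.
move=> H1 H2 e0.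
have [a1 f1 ba] := exists_forbidden lam1 b.
have [a f2 aa] := exists_forbidden lam2 a1.
have {f1}f1 := forbidden_le f1 aa.
have [//|Hn] := pselect (exists x, [/\ b <= x, forbidden lam1 x, forbidden lam2 x &
    tailnorm lam1 x + tailnorm lam2 x <= e]).
have Ht x : a <= x -> e <= tailnorm lam1 x + tailnorm lam2 x.
  move=> ax; rewrite leNgt; apply/negP => /ltW te; apply: Hn; exists x.
  by split=> //; [lra|exact: forbidden_le f1 ax|exact: forbidden_le f2 ax].
pose h x := prodsol lam1 x + prodsol lam2 x.
have h0 x : a <= x -> h x <= 0.
  move=> ax; have := decays_prodsol H1 (forbidden_le f1 ax).
  by have := decays_prodsol H2 (forbidden_le f2 ax); rewrite /h; lra.
pose s := 2 * (1 - h a) / e.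
have s0 : 0 <= s by rewrite divr_ge0 ?ltW // mulr_gt0 //; have := h0 a (lexx _); lra.
have as_ : a <= a + s by rewrite lerDl.
have : h a - e / 2 * a <= h (a + s) - e / 2 * (a + s).
  apply: (derive_ge0_le (F := fun x => h x - e / 2 * x)
    (f := fun x => v lam1 x ^+ 2 + (x - lam1 - c x ^+ 2) * u lam1 x ^+ 2 +
      (v lam2 x ^+ 2 + (x - lam2 - c x ^+ 2) * u lam2 x ^+ 2) - e / 2)) => // x /andP[ax _].
    have x0 := forbidden_ge0 (forbidden_le f1 ax).
    have := prodsol_derive lam1 x0 => ?; have := prodsol_derive lam2 x0 => ?.
    by rewrite /h; apply: is_derive_eq; rewrite /GRing.scale /=; ring.
  have := prodsol_rate_ge (forbidden_le f1 ax); have := prodsol_rate_ge (forbidden_le f2 ax).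
  by have := Ht x ax; lra.
have := h0 _ as_; have : e / 2 * s = 1 - h a by rewrite /s; field; rewrite gt_eqF.
lra.
Qed.

End Dichotomy.

(** * Counting zeros *)

Section Comparison.
Context {R : realType}.
Implicit Types (x y t a b e : R).

Lemma last_nonneg (D : R -> R) a b : a <= b ->
  (forall x, a <= x <= b -> {for x, continuous D}) -> 0 <= D a -> D b < 0 ->
  exists s, [/\ a <= s, s < b, 0 <= D s & forall t, s < t <= b -> D t < 0].
Proof.
move=> ab cD Da Db.
pose S := [set t | a <= t <= b /\ 0 <= D t].
have Sa : S a by split; rewrite ?lexx.
have ubS : has_ubound S by exists b => t [/andP[]].
have supS : has_sup S by split => //; exists a.
pose s := sup S.
have as_ : a <= s by apply: ub_le_sup.
have sb : s <= b by apply: ge_sup; [exists a|move=> t [/andP[]]].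
have Ds : 0 <= D s.
  rewrite leNgt; apply/negP => Ds0.
  have Ds1 : 0 < - D s by rewrite oppr_gt0.
  have /continuous_forP/(_ _ Ds1)[d d0 H] := cD s (introT andP (conj as_ sb)).
  have [t St sdt] := sup_adherent d0 supS.
  have ts : t <= s by apply: ub_le_sup.
  have [_ Dt] := St.
  have : `|D t - D s| < - D s by apply: H; rewrite -/s in sdt; rewrite ler0_norm; lra.
  by rewrite ltr_norml => /andP[_]; lra.
exists s; split => //.
  rewrite lt_neqAle sb andbT; apply: contraTN Db => /eqP <-.
  by rewrite -leNgt.
move=> t /andP[st tb]; rewrite ltNge; apply/negP => Dt.
have : t <= s by apply: ub_le_sup => //; split=> //; rewrite tb andbT; lra.
by rewrite leNgt st.
Qed.

(** After the last point where [D = y2 - y1] is nonnegative, [|D| = - D], so the hypothesis reads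
    [D' >= K D] and [D exp (- K x)] cannot decrease to a negative value. *)
Lemma ode_comparison (y1 y2 g1 g2 : R -> R) (K a b : R) : a <= b ->
  (forall x, a <= x <= b -> is_derive x 1 y1 (g1 x)) ->
  (forall x, a <= x <= b -> is_derive x 1 y2 (g2 x)) ->
  (forall x, a <= x <= b -> - (K * `|y2 x - y1 x|) <= g2 x - g1 x) ->
  y1 a <= y2 a -> y1 b <= y2 b.
Proof.
move=> ab d1 d2 H ya; rewrite leNgt; apply/negP => yb.
pose D x := y2 x - y1 x.
have dD x : a <= x <= b -> is_derive x 1 D (g2 x - g1 x).
  by move=> xab; have := d1 x xab => ?; have := d2 x xab => ?; exact: is_deriveB.
have [|||s [as_ sb Ds Dneg]] := last_nonneg (D := D) ab.
- by move=> x xab; exact: is_derive_continuous (dD x xab).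
- by rewrite subr_ge0.
- by rewrite subr_lt0.
have de x : is_derive x 1 (fun x => expR (- (K * x))) (expR (- (K * x)) * - K).
  apply: (@is_derive1_comp _ expR); apply: is_derive_eq.
  by rewrite /GRing.scale /=; ring.
have [|t /andP[st tb] E] := derive_mvt (F := fun x => D x * expR (- (K * x)))
  (f := fun x => (g2 x - g1 x - K * D x) * expR (- (K * x))) sb.
  move=> x /andP[sx xb].
  have := dD x (introT andP (conj (le_trans as_ sx) xb)) => ?; have := de x => ?.
  by apply: is_derive_eq; rewrite /GRing.scale /=; ring.
have Dt : D t < 0 by apply: Dneg; rewrite st ltW.
have := H t (introT andP (conj (le_trans as_ (ltW st)) (ltW tb))).
rewrite -/(D t) ltr0_norm // => Ht.
have h1 : 0 <= (g2 t - g1 t - K * D t) * expR (- (K * t)) * (b - s).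
  by rewrite !mulr_ge0 ?expR_ge0 //; lra.
have h2 : 0 <= D s * expR (- (K * s)) by rewrite mulr_ge0 ?expR_ge0.
have h3 : D b * expR (- (K * b)) < 0.
  by rewrite pmulr_llt0 ?expR_gt0 // subr_lt0.
lra.
Qed.

Lemma sinDnpi a (m : nat) : sin (a + m%:R * pi) = (-1) ^+ m * sin a.
Proof.
elim: m => [|m IH]; first by rewrite mul0r addr0 expr0 mul1r.
by rewrite -natr1 mulrDl mul1r addrA sinDpi IH exprS; ring.
Qed.

Lemma sin_npi (m : nat) : sin (m%:R * pi) = 0 :> R.
Proof. by rewrite -[m%:R * _]add0r sinDnpi sin0 mulr0. Qed.

Lemma cos_npi (m : nat) : cos (m%:R * pi) ^+ 2 = 1 :> R.
Proof. by have := cos2Dsin2 (m%:R * pi : R); rewrite sin_npi expr0n addr0. Qed.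

End Comparison.

(** * The angle and the zero count as functions of the spectral parameter *)

Section Oscillation.
Context {R : realType}.
Variable q : R -> R.
Hypothesis hq : L1_halfline q.
Implicit Types (x y t lam a b e : R) (m k : nat).

Notation u lam := (sol hq lam).
Notation v lam := (qsol hq lam).
Notation c := (qtail q).
Notation th lam := (theta hq lam).
Notation rate := (angle_rhs q).

Definition lipK lam b := 2 * (1 + qmass q) ^+ 2 + `|lam| + b.

Lemma lipK_ge0 lam b : 0 <= b -> 0 <= lipK lam b.
Proof.
move=> b0; rewrite !addr_ge0 // mulr_ge0 // exprn_ge0 // addr_ge0 //.
exact: qmass_ge0.
Qed.

Lemma rate_lip lam x b (p r : R) : 0 <= x -> x <= b ->
  `|rate lam x p - rate lam x r| <= lipK lam b * `|p - r|.
Proof.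
move=> x0 xb; apply: (le_trans (angle_rhs_lip hq lam p r x0)).
by rewrite ler_wpM2r // lerD2l.
Qed.

(** The rate equals 1 at every multiple of [pi], so such a multiple is crossed upwards only. The
    proof compares the angle with a line of small positive slope issuing from [k pi]. *)
Lemma theta_gt_npi lam x y k : 0 <= x -> x < y ->
  k%:R * pi <= th lam x -> k%:R * pi < th lam y.
Proof.
move=> x0 xy kx.
have y0 : 0 <= y by lra.
pose K := lipK lam y.
have K0 : 0 <= K := lipK_ge0 lam y0.
(* The slope solves [eta + K eta (y - x) = 1]: the loss from the Lipschitz bound along the barrier
   is then at most [1 - eta]. *)
pose eta := (1 + K * (y - x))^-1.
have Kyx : 0 <= K * (y - x) by rewrite mulr_ge0 // subr_ge0 ltW.
have eta0 : 0 < eta by rewrite invr_gt0; lra.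
have etaE : eta * (1 + K * (y - x)) = 1 by rewrite mulVf // gt_eqF //; lra.
have : k%:R * pi + eta * (y - x) <= th lam y.
  apply: (ode_comparison (y1 := fun t => k%:R * pi + eta * (t - x)) (y2 := th lam)
    (g1 := fun=> eta) (g2 := fun t => rate lam t (th lam t)) (K := K) (ltW xy)).
  - by move=> t _; apply: is_derive_eq; rewrite /GRing.scale /=; ring.
  - by move=> t /andP[xt _]; apply: theta_derive; lra.
  - move=> t /andP[xt ty].
    have t0 : 0 <= t by lra.
    have := rate_lip lam (th lam t) (k%:R * pi) t0 ty.
    rewrite {2}/angle_rhs sin_npi mulr0 subr0 expr0n mulr0 addr0 cos_npi -/K => h1.
    have h2 : `|th lam t - k%:R * pi| <= `|th lam t - (k%:R * pi + eta * (t - x))| + eta * (t - x).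
      have tx0 : 0 <= eta * (t - x) by apply: mulr_ge0; lra.
      rewrite -[X in _ <= _ + X](ger0_norm tx0).
      apply: le_trans (ler_normD _ _).
      by rewrite [X in _ <= `|X|](_ : _ = th lam t - k%:R * pi) //; ring.
    have h3 := ler_wpM2l K0 h2.
    have h4 : K * (eta * (t - x)) <= eta * (K * (y - x)).
      by rewrite mulrCA ler_wpM2l ?(ltW eta0) // ler_wpM2l //; lra.
    move: h1; rewrite ler_norml => /andP[h1 _]; lra.
  - by rewrite subrr mulr0 addr0.
by apply: lt_le_trans; rewrite ltrDl mulr_gt0 // subr_gt0.
Qed.

Lemma theta_gt0 lam x : 0 <= x -> 0 < th lam x.
Proof.
have h : 0 < th lam 0 by rewrite theta_0; exact: theta0_gt0.
rewrite le_eqVlt => /predU1P[<-//|x0].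
by have := @theta_gt_npi lam 0 x 0 (lexx _) x0; rewrite mul0r; apply; exact: ltW.
Qed.

Lemma theta_mono lam lam' x : lam <= lam' -> 0 <= x -> th lam x <= th lam' x.
Proof.
move=> ll x0.
apply: (ode_comparison (y1 := th lam) (y2 := th lam') (g1 := fun t => rate lam t (th lam t))
    (g2 := fun t => rate lam' t (th lam' t)) (K := lipK lam x) x0).
- by move=> t /andP[t0 _]; exact: theta_derive.
- by move=> t /andP[t0 _]; exact: theta_derive.
- move=> t /andP[t0 tx].
  have := rate_lip lam (th lam' t) (th lam t) t0 tx.
  rewrite ler_norml => /andP[h _].
  have -> : rate lam' t (th lam' t) = rate lam t (th lam' t) + (lam' - lam) * sin (th lam' t) ^+ 2.
    by rewrite /angle_rhs; ring.
  have : 0 <= (lam' - lam) * sin (th lam' t) ^+ 2 by rewrite mulr_ge0 ?sqr_ge0 // subr_ge0.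
  lra.
- by rewrite !theta_0.
Qed.

Lemma sin2_le1 (p : R) : sin p ^+ 2 <= 1.
Proof. by have := cos2Dsin2 p; have := sqr_ge0 (cos p); lra. Qed.

Lemma theta_cont_lam lam x e : 0 <= x -> 0 < e ->
  exists2 d : R, 0 < d & forall lam', `|lam' - lam| < d -> `|th lam' x - th lam x| < e.
Proof.
move=> x0 e0; pose K := lipK lam x.
have K0 : 0 <= K := lipK_ge0 lam x0.
pose B := expR ((2 * K + 1) * (x - 0)).
have B1 : 1 <= B.
  by rewrite /B -[leLHS]expR0 ler_expR subr0; apply: mulr_ge0; lra.
have B0 : 0 < B by lra.
exists (e / B); first by rewrite divr_gt0.
move=> lam'; set dl := `|lam' - lam| => dlt.
have dl0 : 0 <= dl by exact: normr_ge0.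
(* Adding the constant [dl^2] makes the Gronwall inequality homogeneous: the source term obeys
   [2 |z| dl <= z^2 + dl^2]. *)
have G : (th lam' x - th lam x) ^+ 2 + dl ^+ 2 <=
    ((th lam' 0 - th lam 0) ^+ 2 + dl ^+ 2) * B.
  apply: (gronwall (G := fun t => (th lam' t - th lam t) ^+ 2 + dl ^+ 2)
    (g := fun t => 2 * (th lam' t - th lam t) *
         (rate lam' t (th lam' t) - rate lam t (th lam t)))) => // t /andP[t0 tx].
    have := theta_derive hq lam t0 => ?; have := theta_derive hq lam' t0 => ?.
    by apply: is_derive_eq; rewrite /GRing.scale /=; ring.
  have h := rate_lip lam (th lam' t) (th lam t) t0 tx.
  have -> : rate lam' t (th lam' t) = rate lam t (th lam' t) + (lam' - lam) * sin (th lam' t) ^+ 2.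
    by rewrite /angle_rhs; ring.
  set z := th lam' t - th lam t in h *.
  apply: (le_trans (ler_norm _)); rewrite !normrM (ger0_norm (ler0n _ 2)).
  have h1 : `|rate lam t (th lam' t) + (lam' - lam) * sin (th lam' t) ^+ 2 - rate lam t (th lam t)|
       <= K * `|z| + dl.
    rewrite addrAC; apply: (le_trans (ler_normD _ _)); apply: lerD => //.
    by rewrite normrM -/dl ler_piMr // ger0_norm ?sqr_ge0 // sin2_le1.
  have h2 : 2 * `|z| * (K * `|z| + dl) <= (2 * K + 1) * (z ^+ 2 + dl ^+ 2).
    rewrite -(real_normK (num_real z)).
    have := sqr_ge0 (`|z| - dl); have : 0 <= K * dl ^+ 2 by rewrite mulr_ge0 ?sqr_ge0.
    lra.
  by apply: le_trans h2; rewrite ler_wpM2l // mulr_ge0.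
rewrite !theta_0 subrr expr0n add0r in G.
have : `|th lam' x - th lam x| ^+ 2 < e ^+ 2.
  rewrite real_normK ?num_real //.
  have : dl * B < e by rewrite -ltr_pdivlMr.
  have h : 0 <= dl * B by rewrite mulr_ge0 // ltW.
  move=> h1; have : (dl * B) ^+ 2 < e ^+ 2 by rewrite ltrXn2r.
  have : dl ^+ 2 * B <= (dl * B) ^+ 2.
    by rewrite exprMn ler_wpM2l ?sqr_ge0 // expr2 ler_peMl // ltW.
  by have := sqr_ge0 dl; lra.
by rewrite ltr_pXn2r // nnegrE ltW.
Qed.

Lemma flux_theta lam x : flux hq lam x =
  amplitude hq lam x ^+ 2 * (sin (th lam x) * (sin (th lam x) + cos (th lam x))).
Proof. by rewrite /flux /sol /qsol; ring. Qed.

Lemma flux_npi lam x k : th lam x = k%:R * pi -> flux hq lam x = 0.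
Proof. by move=> E; rewrite flux_theta E sin_npi mul0r mulr0. Qed.

(** The sign of [flux] depends on the angle alone, so continuity of the angle in [lam] suffices. *)
Lemma flux_cont_lam lam x : 0 <= x -> 0 < flux hq lam x ->
  exists2 d : R, 0 < d & forall lam', `|lam' - lam| < d -> 0 < flux hq lam' x.
Proof.
move=> x0; rewrite flux_theta pmulr_rgt0 ?exprn_gt0 ?amplitude_gt0 //.
set w := fun p : R => sin p * (sin p + cos p).
rewrite -/(w (th lam x)) => w0.
have cw : {for th lam x, continuous w}.
  by apply: cvgM; [exact: continuous_sin|apply: cvgD; [exact: continuous_sin|exact: continuous_cos]].
have /continuous_forP/(_ _ w0)[d1 d10 H1] := cw.
have [d d0 H] := theta_cont_lam lam x0 d10.
exists d => // lam' /H/H1; rewrite ltr_norml => /andP[h _].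
by rewrite flux_theta pmulr_rgt0 ?exprn_gt0 ?amplitude_gt0 // -/(w (th lam' x)); lra.
Qed.

Variable X : R.
Hypothesis X0 : 0 <= X.
Hypothesis HX : forall x, X <= x -> `|c x| <= 1 / 2.

Notation forbidden := (forbidden X).
Notation decays := (decays hq X).

(** Reaching a multiple of [pi] would be a zero of [u], hence of [flux]. *)
Lemma theta_lt_no_zero lam a y m : forbidden lam a -> a <= y ->
  (forall t, a < t -> flux hq lam t != 0) ->
  th lam a < m%:R * pi -> th lam y < m%:R * pi.
Proof.
move=> fa ay Hf tha; rewrite ltNge; apply/negP => thy.
have [|z /andP[az zy] E] := cont_ge0_ivt (v := m%:R * pi) (forbidden_ge0 X0 fa) ay
  (cont_theta (hq := hq) (lam := lam)).
  by rewrite thy andbT ltW.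
move: az; rewrite le_eqVlt => /predU1P[az|az]; first by move: tha; rewrite az E ltxx.
by have := Hf z az; rewrite (flux_npi E) eqxx.
Qed.

Lemma theta_lt_grow lam a y m : forbidden lam a -> a <= y -> 0 <= flux hq lam a ->
  th lam a < m%:R * pi -> th lam y < m%:R * pi.
Proof.
move=> fa ay Pa; apply: theta_lt_no_zero => // t at_.
by rewrite gt_eqF // (le_lt_trans Pa) // (flux_incr hq X0 HX).
Qed.

Lemma theta_lt_decay lam a y m : decays lam -> forbidden lam a -> a <= y ->
  th lam a < m%:R * pi -> th lam y < m%:R * pi.
Proof.
move=> Hd fa ay; apply: theta_lt_no_zero => // t at_.
by rewrite lt_eqF // Hd // (forbidden_le fa) // ltW.
Qed.

(** Meeting two successive multiples of [pi] would give two zeros of the strictly increasing [flux]: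
    at most one zero of [u] lies in the forbidden region. *)
Lemma theta_lt_succ lam a y m : forbidden lam a -> a <= y ->
  th lam a < m%:R * pi -> th lam y < m.+1%:R * pi.
Proof.
move=> fa ay tha; rewrite ltNge; apply/negP => thy.
have pi0 := pi_gt0 R.
have mS : m%:R * pi < m.+1%:R * pi :> R by rewrite ltr_pM2r // ltr_nat.
have a0 := forbidden_ge0 X0 fa.
have ct := cont_theta (hq := hq) (lam := lam).
have [|z /andP[az zy] E] := cont_ge0_ivt (v := m%:R * pi) a0 ay ct.
  by rewrite (ltW tha) (le_trans (ltW mS)).
have [|z' /andP[zz' zy'] E'] := cont_ge0_ivt (v := m.+1%:R * pi) (le_trans a0 az) zy ct.
  by rewrite E (ltW mS).
move: zz'; rewrite le_eqVlt => /predU1P[zz'|zz'].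
  by move: mS; rewrite -E -E' zz' ltxx.
by have := flux_incr hq X0 HX (forbidden_le fa az) zz'; rewrite (flux_npi E) (flux_npi E') ltxx.
Qed.

(* [zeros lam m]: the solution has exactly [m] zeros. *)
Definition zeros lam m := exists2 b, forbidden lam b &
  forall x, b <= x -> m%:R * pi < th lam x < m.+1%:R * pi.

Lemma exists_strip lam x : 0 <= x -> exists m, m%:R * pi <= th lam x < m.+1%:R * pi.
Proof.
move=> x0; have pi0 := pi_gt0 R; exists (Num.truncn (th lam x / pi)).
rewrite -ler_pdivlMr // -ltr_pdivrMr //.
apply: truncn_itv; rewrite divr_ge0 // ?ltW //; exact: theta_gt0.
Qed.

Lemma zeros_intro lam a m : forbidden lam a -> decays lam \/ 0 <= flux hq lam a ->
  m%:R * pi <= th lam a < m.+1%:R * pi -> zeros lam m.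
Proof.
move=> fa Hd /andP[h1 h2]; exists (a + 1).
  by apply: forbidden_le fa _; rewrite lerDl.
move=> x ax; have ax' : a < x by lra.
rewrite (theta_gt_npi (forbidden_ge0 X0 fa) ax' h1) /=.
case: Hd => Hd.
  exact: theta_lt_decay Hd fa (ltW ax') h2.
exact: theta_lt_grow fa (ltW ax') Hd h2.
Qed.

Lemma exists_zeros lam : exists m, zeros lam m.
Proof.
have [a fa Ha] : exists2 a, forbidden lam a & decays lam \/ 0 <= flux hq lam a.
  have [Hd|Hd] := pselect (decays lam).
    by have [a fa _] := exists_forbidden X lam 0; exists a => //; left.
  have /existsNP[a /not_implyP[fa Pa]] := Hd.
  by exists a => //; right; rewrite leNgt; apply/negP.
have [m hm] := exists_strip lam (forbidden_ge0 X0 fa).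
by exists m; exact: zeros_intro hm.
Qed.

Lemma strip_le m k (p : R) : m%:R * pi < p -> p < k.+1%:R * pi -> (m <= k)%N.
Proof.
move=> h1 h2; have := lt_trans h1 h2.
by rewrite ltr_pM2r ?pi_gt0 // ltr_nat ltnS.
Qed.

Lemma zeros_mono lam lam' m m' : lam <= lam' -> zeros lam m -> zeros lam' m' -> (m <= m')%N.
Proof.
move=> ll [b fb Hb] [b' fb' Hb'].
pose x := Num.max b b'.
have /Hb/andP[h1 _] : b <= x by rewrite le_max lexx.
have /Hb'/andP[_ h2] : b' <= x by rewrite le_max lexx orbT.
apply: (@strip_le _ _ (th lam' x)) => //; apply: lt_le_trans h1 _.
by apply: theta_mono => //; rewrite le_max (forbidden_ge0 X0 fb).
Qed.

Lemma zeros_uniq lam m m' : zeros lam m -> zeros lam m' -> m = m'.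
Proof. by move=> h h'; apply/eqP; rewrite eqn_leq !(zeros_mono (lexx lam)). Qed.

Lemma strip_cont_lam lam x m : 0 <= x -> m%:R * pi < th lam x < m.+1%:R * pi ->
  exists2 d : R, 0 < d & forall lam', `|lam' - lam| < d -> m%:R * pi < th lam' x < m.+1%:R * pi.
Proof.
move=> x0 /andP[h1 h2].
pose e := Num.min (th lam x - m%:R * pi) (m.+1%:R * pi - th lam x).
have e0 : 0 < e by rewrite lt_min !subr_gt0 h1.
have [d d0 H] := theta_cont_lam lam x0 e0.
exists d => // lam' /H; rewrite lt_min !ltr_norml => /andP[/andP[? _] /andP[_ ?]].
by apply/andP; split; lra.
Qed.

Lemma forbidden_near lam lam' b : forbidden lam b -> `|lam' - lam| < 1 ->
  forbidden lam' (b + 1).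
Proof.
by move=> /andP[? ?]; rewrite ltr_norml => /andP[? ?]; apply/andP; split; lra.
Qed.

(** By continuity the angle at [b + 1] stays in the same strip, and beyond that point at most one
    more multiple of [pi] can be passed. Using [b + 1] instead of [b] keeps the point forbidden for
    every parameter within distance 1. *)
Lemma zeros_near lam m : zeros lam m -> exists2 d : R, 0 < d &
  forall lam', `|lam' - lam| < d -> zeros lam' m \/ zeros lam' m.+1.
Proof.
move=> [b fb Hb].
have b0 : 0 <= b + 1 by have := forbidden_ge0 X0 fb; lra.
have [|d d0 H] := strip_cont_lam (x := b + 1) (lam := lam) (m := m) b0.
  by apply: Hb; rewrite lerDl.
exists (Num.min d 1); first by rewrite lt_min d0 ltr01.
move=> lam'; rewrite lt_min => /andP[/H/andP[h1 h2] /(forbidden_near fb) fb'].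
have [m' Hm'] := exists_zeros lam'.
have [b' _ Hb'] := Hm'.
pose x := Num.max (b + 2) b'.
have bx : b + 1 < x by rewrite lt_max; apply/orP; left; lra.
have /Hb'/andP[h3 h4] : b' <= x by rewrite le_max lexx orbT.
have h5 := theta_gt_npi b0 bx (ltW h1).
have h6 := theta_lt_succ fb' (ltW bx) h2.
have : (m' <= m.+1)%N := strip_le h3 h6.
have : (m <= m')%N := strip_le h5 h4.
rewrite leq_eqVlt => /predU1P[->|]; first by left.
by move=> h7 h8; right; rewrite (_ : m.+1 = m') //; apply/eqP; rewrite eqn_leq h7.
Qed.

(** For a growing solution positivity of [flux] at a far point is an open condition in [lam], and it
    excludes any later zero. *)
Lemma zeros_near_grow lam m : ~ decays lam -> zeros lam m -> exists2 d : R, 0 < d &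
  forall lam', `|lam' - lam| < d -> zeros lam' m.
Proof.
move=> /existsNP[a /not_implyP[fa /negP Pa]] [b fb Hb].
rewrite -leNgt in Pa.
pose x := Num.max a b + 1.
have ax : a < x by rewrite (@le_lt_trans _ _ (Num.max a b)) ?ltrDl // le_max lexx.
have bx : b < x by rewrite (@le_lt_trans _ _ (Num.max a b)) ?ltrDl // le_max lexx orbT.
have fab : forbidden lam (Num.max a b) by apply: forbidden_le fa _; rewrite le_max lexx.
have x0 : 0 <= x by have := forbidden_ge0 X0 fab; rewrite /x; lra.
have Px : 0 < flux hq lam x := le_lt_trans Pa (flux_incr hq X0 HX fa ax).
have [d1 d10 H1] := strip_cont_lam x0 (Hb x (ltW bx)).
have [d2 d20 H2] := flux_cont_lam x0 Px.
exists (Num.min (Num.min d1 d2) 1); first by rewrite !lt_min d10 d20 ltr01.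
move=> lam'; rewrite !lt_min => /andP[/andP[/H1/andP[h1 h2] /H2 h3] /(forbidden_near fab) fx].
by apply: zeros_intro fx (or_intror (ltW h3)) _; rewrite (ltW h1).
Qed.

Lemma zeros_step lam lam' m m' : lam < lam' ->
  (forall l, lam < l < lam' -> ~ decays l) ->
  zeros lam m -> zeros lam' m' -> (m' <= m.+1)%N.
Proof.
move=> ll Hno Hm Hm'.
have [Z HZ] := choice exists_zeros.
have [d1 d10 H1] := zeros_near Hm.
have [d2 d20 H2] := zeros_near Hm'.
pose e := Num.min (Num.min d1 d2) (lam' - lam) / 3.
have e0 : 0 < e by rewrite divr_gt0 // !lt_min d10 d20 subr_gt0.
have [e1 e2 e3] : [/\ e < d1, e < d2 & 3 * e <= lam' - lam].
  have : Num.min (Num.min d1 d2) (lam' - lam) = 3 * e by rewrite /e; field.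
  have : Num.min (Num.min d1 d2) (lam' - lam) <= d1 by rewrite !ge_min lexx.
  have : Num.min (Num.min d1 d2) (lam' - lam) <= d2 by rewrite !ge_min lexx orbT.
  have : Num.min (Num.min d1 d2) (lam' - lam) <= lam' - lam by rewrite !ge_min lexx orbT.
  by split; lra.
(* The locally constant count, read as a real function, has zero derivative, so the mean value
   theorem makes it constant. *)
have E : Z (lam + e) = Z (lam' - e).
  have le : lam + e < lam' - e by lra.
  have [l /andP[l1 l2]|l _] := derive_mvt (F := fun l => (Z l)%:R : R) (f := fun=> 0) le.
    have [|d d0 H] := zeros_near_grow _ (HZ l); first by apply: Hno; apply/andP; split; lra.
    apply: (near_eq_is_derive (f := fun=> (Z l)%:R : R)) => //.
    apply/nbhs_ballP; exists d => //= l' /=; rewrite /ball /= distrC => /H.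
    by move=> /zeros_uniq/(_ (HZ l')) ->.
  by rewrite mul0r => /eqP; rewrite subr_eq0 eqr_nat => /eqP ->.
have h1 : (Z (lam + e)%R <= m.+1)%N.
  have : `|lam + e - lam| < d1 by rewrite addrAC subrr add0r gtr0_norm.
  by move=> /H1[] /zeros_uniq/(_ (HZ (lam + e))) <-.
have h2 : (m' <= Z (lam' - e)%R)%N.
  have : `|lam' - e - lam'| < d2 by rewrite addrAC subrr add0r normrN gtr0_norm.
  by move=> /H2[] /zeros_uniq/(_ (HZ (lam' - e))) <-.
by rewrite (leq_trans h2) // -E.
Qed.

Lemma wronskian_ring (r1 r2 s1 s2 c1 c2 : R) :
  r1 * s1 * (r2 * c2) - r1 * c1 * (r2 * s2) = - (r1 * r2 * (s2 * c1 - c2 * s1)).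
Proof. by ring. Qed.

(** With equal counts the two solutions have the same sign far out, so their Wronskian is strictly
    decreasing there. It starts nonpositive, yet must be small at some far point because both
    solutions decay. *)
Lemma zeros_strict lam lam' m m' : lam < lam' -> decays lam -> decays lam' ->
  zeros lam m -> zeros lam' m' -> (m < m')%N.
Proof.
move=> ll Hd Hd' Hm Hm'; rewrite ltn_neqAle (zeros_mono (ltW ll) Hm Hm') andbT.
apply/eqP => mm; rewrite -{m'}mm in Hm'.
have [b fb Hb] := Hm; have [b' fb' Hb'] := Hm'.
pose W x := u lam x * v lam' x - v lam x * u lam' x.
have dW x : 0 <= x -> is_derive x 1 W (- ((lam' - lam) * (u lam x * u lam' x))).
  move=> x0; have := sol_derive hq lam x0 => ?; have := qsol_derive hq lam x0 => ?.
  have := sol_derive hq lam' x0 => ?; have := qsol_derive hq lam' x0 => ?.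
  by rewrite /W; apply: is_derive_eq; rewrite /GRing.scale /=; ring.
pose a := Num.max b b'.
have ba : b <= a by rewrite le_max lexx.
have ba' : b' <= a by rewrite le_max lexx orbT.
have a0 : 0 <= a := le_trans (forbidden_ge0 X0 fb) ba.
have uu x : a <= x -> 0 < u lam x * u lam' x.
  move=> ax; have /andP[h1 h2] := Hb x (le_trans ba ax).
  have /andP[h3 h4] := Hb' x (le_trans ba' ax).
  rewrite -natr1 mulrDl mul1r in h2 h4.
  have s1 : 0 < sin (th lam x - m%:R * pi) by apply: sin_gt0_pi; apply/andP; split; lra.
  have s2 : 0 < sin (th lam' x - m%:R * pi) by apply: sin_gt0_pi; apply/andP; split; lra.
  rewrite /sol mulrACA; apply: mulr_gt0.
    by apply: mulr_gt0; exact: amplitude_gt0.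
  rewrite -[th lam x](subrK (m%:R * pi)) -[th lam' x](subrK (m%:R * pi)) !sinDnpi.
  by rewrite mulrACA -expr2 sqrr_sign mul1r mulr_gt0.
have Wdec x y : a <= x -> x < y -> W y < W x.
  move=> ax xy; rewrite -ltrN2.
  apply: (derive_gt0_lt (F := fun x => - W x)
    (f := fun x => (lam' - lam) * (u lam x * u lam' x)) xy) => z /andP[xz zy].
    have := dW z (le_trans a0 (le_trans ax xz)) => ?.
    by apply: is_derive_eq; rewrite opprK.
  by rewrite mulr_gt0 ?subr_gt0 // uu // (le_trans ax) // ltW.
(* In polar form the Wronskian is [- r r' sin (th' - th)], and the angles are ordered and lie in the
   same strip of width [pi]. *)
have Wa : W a <= 0.
  have -> : W a = - (amplitude hq lam a * amplitude hq lam' a * sin (th lam' a - th lam a)).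
    by rewrite sinB; exact: wronskian_ring.
  rewrite oppr_le0; apply: mulr_ge0.
    by apply: mulr_ge0; apply: ltW; exact: amplitude_gt0.
  have := theta_mono (ltW ll) a0.
  have /andP[h1 h2] := Hb a ba; have /andP[h3 h4] := Hb' a ba'.
  rewrite -natr1 mulrDl mul1r in h2 h4 => h5.
  by apply: sin_ge0_pi; apply/andP; split; lra.
have a1 : a < a + 1 by rewrite ltrDl.
have W1 : 0 < - W (a + 1) by have := Wdec _ _ (lexx a) a1; lra.
have [x [ax f1 f2 Hx]] := tailnorm_small X0 HX (a + 2) Hd Hd' W1.
have ax1 : a + 1 < x by lra.
have := Wdec _ _ (ltW a1) ax1.
have T l : forbidden l x -> u l x ^+ 2 + v l x ^+ 2 <= tailnorm hq l x.
  move=> /andP[_ fx]; rewrite /tailnorm.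
  have : 0 <= (x - l - 1) * u l x ^+ 2 by rewrite mulr_ge0 ?sqr_ge0 //; lra.
  lra.
have := T lam f1; have := T lam' f2.
(* These two squares give [- 2 W x <= tailnorm lam x + tailnorm lam' x <= - W (a + 1)], against
   [- W x > - W (a + 1) > 0]. *)
have : 0 <= (u lam x + v lam' x) ^+ 2 := sqr_ge0 _.
have : 0 <= (v lam x - u lam' x) ^+ 2 := sqr_ge0 _.
rewrite /W in Hx W1 *; lra.
Qed.

End Oscillation.

(** * The phase at the turning point *)

Section Phase.
Context {R : realType}.
Variable q : R -> R.
Hypothesis hq : L1_halfline q.
Implicit Types (x y t lam a b e : R) (m k : nat).

Notation c := (qtail q).
Notation th lam := (theta hq lam).
Notation rate := (angle_rhs q).

(** Numerator of the quotient rule for the argument of [atan] in [scaled_angle]; the factor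
    [C^2 + S^2] is 1 when substituted. *)
Lemma scaled_angle_ring (K K' C S T : R) :
  (K' * (S * C) + (K - 1) * (C ^+ 2 - S ^+ 2) * T) * (C ^+ 2 + K * S ^+ 2) -
  ((K - 1) * (S * C)) * (K' * S ^+ 2 + 2 * (K - 1) * (S * C) * T) =
  (K' * (S * C) + (K - 1) * T * (C ^+ 2 - K * S ^+ 2)) * (C ^+ 2 + S ^+ 2).
Proof. ring. Qed.

Lemma scaled_norm_ring (K C S : R) :
  (C ^+ 2 + K * S ^+ 2) ^+ 2 + ((K - 1) * (S * C)) ^+ 2 =
  (C ^+ 2 + K ^+ 2 * S ^+ 2) * (C ^+ 2 + S ^+ 2).
Proof. ring. Qed.

(* If [tan T = u / v] then [scaled_angle K T] is the angle with tangent
   [K u / v], in the same quadrant as [T]. *)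
Definition scaled_angle (K T : R) :=
  T + atan ((K - 1) * (sin T * cos T) / (cos T ^+ 2 + K * sin T ^+ 2)).

Lemma scaled_norm_gt0 (K T : R) : 0 < K -> 0 < cos T ^+ 2 + K * sin T ^+ 2.
Proof.
move=> K0; have := cos2Dsin2 T; have := sqr_ge0 (cos T); have := sqr_ge0 (sin T).
rewrite le_eqVlt => /predU1P[<-|s0] c0; first by rewrite mulr0 !addr0 => ->.
by move=> _; rewrite ltr_wpDl // mulr_gt0.
Qed.

(** This is the derivative of [atan (K tan T)], valid also where [cos T = 0]: for [K > 0] the
    denominator inside [atan] is positive, so no branch is crossed. *)
Lemma scaled_angle_derive (K T : R -> R) x (K' T' : R) : 0 < K x ->
  is_derive x 1 K K' -> is_derive x 1 T T' ->
  is_derive x 1 (fun y => scaled_angle (K y) (T y))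
    ((K' * (sin (T x) * cos (T x)) + K x * T') / (cos (T x) ^+ 2 + K x ^+ 2 * sin (T x) ^+ 2)).
Proof.
move=> K0 dK dT.
have dS : is_derive x 1 (fun y => sin (T y)) (cos (T x) * T') by exact: (@is_derive1_comp _ sin).
have dC : is_derive x 1 (fun y => cos (T y)) (- sin (T x) * T') by exact: (@is_derive1_comp _ cos).
pose N y := (K y - 1) * (sin (T y) * cos (T y)).
pose D y := cos (T y) ^+ 2 + K y * sin (T y) ^+ 2.
have D0 : 0 < D x := scaled_norm_gt0 _ K0.
have Dn0 : D x != 0 by rewrite gt_eqF.
set C := cos (T x) in dS dC *; set S := sin (T x) in dS dC *.
have CS : C ^+ 2 + S ^+ 2 = 1 by exact: cos2Dsin2.
have dN : is_derive x 1 N (K' * (S * C) + (K x - 1) * (C ^+ 2 - S ^+ 2) * T').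
  by rewrite /N; apply: is_derive_eq; rewrite /GRing.scale /= -/S -/C; ring.
have dD : is_derive x 1 D (K' * S ^+ 2 + 2 * (K x - 1) * (S * C) * T').
  by rewrite /D; apply: is_derive_eq; rewrite /GRing.scale /= -/S -/C; ring.
have dV := is_deriveV Dn0 dD.
have dB : is_derive x 1 (fun y => N y / D y)
   (((K' * (S * C) + (K x - 1) * (C ^+ 2 - S ^+ 2) * T') * D x
     - N x * (K' * S ^+ 2 + 2 * (K x - 1) * (S * C) * T')) / D x ^+ 2).
  by apply: is_derive_eq; rewrite /GRing.scale /=; field.
have dA : is_derive x 1 (fun y => atan (N y / D y)) _ := @is_derive1_comp _ atan _ _ _ _ _ dB.
rewrite /scaled_angle; apply: is_derive_eq.
rewrite scaled_angle_ring CS mulr1.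
have E2 := scaled_norm_ring (K x) C S; rewrite CS mulr1 in E2.
have Q0 : C ^+ 2 + K x ^+ 2 * S ^+ 2 != 0.
  by rewrite -E2 gt_eqF // ltr_pwDl ?sqr_ge0 // exprn_gt0.
have -> : (1 + (N x / D x) ^+ 2)^-1 = D x ^+ 2 / (C ^+ 2 + K x ^+ 2 * S ^+ 2).
  have E3 : D x ^+ 2 + N x ^+ 2 = C ^+ 2 + K x ^+ 2 * S ^+ 2 := E2.
  by rewrite -E3 -[RHS]invf_div; congr GRing.inv; field.
rewrite [_ / _ * (_ / _)]mulrC -[_ / _ * (_ / _)]mulrA mulKf ?expf_neq0 //.
apply: (mulIf Q0); rewrite mulrDl !divfK //.
have -> : K x * T' = K x * T' * (C ^+ 2 + S ^+ 2) by rewrite CS mulr1.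
ring.
Qed.

(** With [K^2 - 1 = lam - x] the unscaled rate is [Q = C^2 + K^2 S^2] up to lower-order terms, so
    the scaled rate is [K] plus a remainder. Each of [S C], [2 K S C] and [K S^2] is bounded by [Q],
    which yields the three parts of the constant. *)
Lemma scaled_rate_bound (K K' C S g J : R) : 1 <= K -> `|K'| <= 1 / 2 -> `|g| <= J ->
  C ^+ 2 + S ^+ 2 = 1 ->
  `|(K' * (S * C) + K * ((C - g * S) ^+ 2 + (K ^+ 2 - 1) * S ^+ 2))
     / (C ^+ 2 + K ^+ 2 * S ^+ 2) - K| <= 1 + J + (1 + J ^+ 2).
Proof.
move=> K1 K'1 gJ CS.
have K0 : 0 <= K by lra.
set Q := C ^+ 2 + K ^+ 2 * S ^+ 2.
have Q0 : 0 < Q.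
  have := sqr_ge0 C; have := sqr_ge0 S => s0 c0.
  have : 1 * S ^+ 2 <= K ^+ 2 * S ^+ 2 by rewrite ler_wpM2r // exprn_ege1.
  by rewrite /Q; lra.
have -> : (K' * (S * C) + K * ((C - g * S) ^+ 2 + (K ^+ 2 - 1) * S ^+ 2)) / Q - K =
   (K' * (S * C) - g * (2 * K * (S * C)) + (g ^+ 2 - 1) * (K * S ^+ 2)) / Q.
  by apply: (mulIf (lt0r_neq0 Q0)); rewrite mulrBl !divfK ?gt_eqF // /Q; ring.
rewrite normrM normfV (gtr0_norm Q0) ler_pdivrMr //.
have kSC : `|2 * K * (S * C)| <= Q.
  rewrite /Q ler_norml; apply/andP; split.
    by have := sqr_ge0 (C + K * S); lra.
  by have := sqr_ge0 (C - K * S); lra.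
have SC : `|S * C| <= Q.
  apply: le_trans kSC; rewrite [leRHS]normrM ler_peMl // ger0_norm ?mulr_ge0 //; lra.
have kS : `|K * S ^+ 2| <= Q.
  rewrite ger0_norm /Q; last by apply: mulr_ge0 => //; exact: sqr_ge0.
  have : K * S ^+ 2 <= K ^+ 2 * S ^+ 2 by rewrite ler_wpM2r ?sqr_ge0 // expr2 ler_peMl.
  by have := sqr_ge0 C; lra.
have g2 : `|g ^+ 2 - 1| <= 1 + J ^+ 2.
  apply: (le_trans (ler_normB _ _)); rewrite normr1 addrC lerD2l normrX.
  by rewrite lerXn2r ?nnegrE // (le_trans _ gJ).
have K'2 : `|K'| <= 1 by lra.
rewrite [leRHS]mulrDl [(1 + J) * Q]mulrDl mul1r; apply: (le_trans (ler_normD _ _)); apply: lerD.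
  apply: (le_trans (ler_normB _ _)); apply: lerD; rewrite normrM.
    by rewrite -[leRHS]mul1r; apply: ler_pM.
  by apply: ler_pM.
by rewrite normrM; apply: ler_pM.
Qed.

Definition turning_const := 1 + qmass q + (1 + qmass q ^+ 2).

Lemma turning_const_ge0 : 0 <= turning_const.
Proof. by have := qmass_ge0 q; have := sqr_ge0 (qmass q); rewrite /turning_const; lra. Qed.

Lemma theta_turning lam : 0 < lam ->
  `|th lam lam - 2 / 3 * Num.sqrt (lam + 1) ^+ 3| <= turning_const * lam + 7.
Proof.
move=> lam0.
(* The local frequency shifted by 1, so that [K >= 1] up to the turning point and [K' = - 1 / (2 K)]
   stays bounded. Since [2/3 K^3] has derivative [- K], it cancels the main part of the scaled rate
   in [G]. *)
pose K x := Num.sqrt (lam - x + 1).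
have K1 x : x <= lam -> 1 <= K x.
  by move=> xl; rewrite /K -[leLHS]sqrtr1 ler_wsqrtr //; lra.
have K2 x : x <= lam -> K x ^+ 2 = lam - x + 1.
  by move=> xl; rewrite /K sqr_sqrtr //; lra.
have dK x : 0 <= x <= lam -> is_derive x 1 K (- (2 * K x)^-1).
  move=> /andP[x0 xl].
  have h : 0 < lam - x + 1 by lra.
  have di : is_derive x 1 (fun y : R => lam - y + 1) (- 1).
    by apply: is_derive_eq; ring.
  have ds := is_derive1_sqrt h.
  have := @is_derive1_comp _ Num.sqrt (fun y : R => lam - y + 1) x _ _ ds di.
  by rewrite mulrN1.
pose G x := scaled_angle (K x) (th lam x) + 2 / 3 * K x ^+ 3.
pose al x := (- (2 * K x)^-1 * (sin (th lam x) * cos (th lam x)) + K x * rate lam x (th lam x))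
   / (cos (th lam x) ^+ 2 + K x ^+ 2 * sin (th lam x) ^+ 2).
have dG x : 0 <= x <= lam -> is_derive x 1 G (al x - K x).
  move=> xl; have /andP[x0 xl'] := xl.
  have Kp : 0 < K x by apply: lt_le_trans (K1 x xl').
  have d1 := scaled_angle_derive Kp (dK x xl) (theta_derive hq lam x0).
  have d2 := dK x xl.
  rewrite /G; apply: is_derive_eq; rewrite /GRing.scale /= -/(al x).
  by congr (_ + _); field; rewrite gt_eqF.
have [xi /andP[xi0 xil] E] := derive_mvt lam0 dG.
have Kxi := K1 xi (ltW xil).
have B : `|al xi - K xi| <= turning_const.
  rewrite /al /angle_rhs (_ : lam - xi = K xi ^+ 2 - 1); last by rewrite K2 ?ltW //; ring.
  apply: scaled_rate_bound => //.
  - rewrite normrN normfV gtr0_norm; last by lra.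
    by rewrite mul1r lef_pV2 ?posrE; lra.
  - by apply: qtail_le_mass => //; exact: ltW.
  - exact: cos2Dsin2.
have E' : `|G lam - G 0| <= turning_const * lam.
  by rewrite E subr0 normrM (gtr0_norm lam0) ler_wpM2r // ltW.
have K_lam : K lam = 1 by rewrite /K subrr add0r sqrtr1.
have GE : G lam = th lam lam + 2 / 3.
  by rewrite /G K_lam expr1n mulr1 /scaled_angle subrr !mul0r atan0 addr0.
have K_0 : K 0 = Num.sqrt (lam + 1) by rewrite /K subr0.
rewrite GE /G K_0 /scaled_angle theta_0 in E'.
move: E'; set z := atan _.
have z1 : z < pi / 2 := atan_ltpi2 _.
have z2 : - (pi / 2) < z := atan_gtNpi2 _.
have t1 := theta0_gt0 q; have t2 := theta0_lt q.
have p2 := pihalf_lt2 R.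
(* At [lam] the scaling is trivial because [K = 1]. At 0 the scaled angle is [theta0 + z], with
   [theta0 < pi] and [|z| < pi / 2 < 2]; with the terms [2/3] everything fits into 7. *)
rewrite !ler_norml => /andP[h1 h2]; apply/andP; split; lra.
Qed.

Variable X : R.
Hypothesis X0 : 0 <= X.
Hypothesis HX : forall x, X <= x -> `|c x| <= 1 / 2.

(** From [lam] to [lam + 3] the angle gains at most [3 (1 + qmass)^2]; beyond, at most one multiple
    of [pi] is passed. Rounding to multiples costs at most [pi < 4]. *)
Lemma zeros_turning lam m : X <= lam -> zeros hq X lam m ->
  `|m%:R * pi - th lam lam| <= 3 * (1 + qmass q) ^+ 2 + 4.
Proof.
move=> Xl [b fb Hb].
have pi0 := pi_gt0 R; have p2 := pihalf_lt2 R.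
have lam0 : 0 <= lam := le_trans X0 Xl.
have l3 : 0 <= lam + 3 by lra.
have ll3 : lam < lam + 3 by rewrite ltrDl.
have fl : forbidden X lam (lam + 3) by apply/andP; split; lra.
pose x := Num.max b (lam + 3).
have /Hb/andP[h1 h2] : b <= x by rewrite le_max lexx.
have lx : lam + 3 <= x by rewrite le_max lexx orbT.
have J0 := qmass_ge0 q.
have [k /andP[k1 k2]] := exists_strip hq lam lam0.
have [j /andP[j1 j2]] := exists_strip hq lam l3.
have km : (k <= m)%N.
  by apply: strip_le h2; apply: theta_gt_npi k1 => //; lra.
have mj : (m <= j.+1)%N.
  apply: strip_le h1 _; exact: (theta_lt_succ X0 HX fl lx j2).
have up : th lam (lam + 3) <= th lam lam + 3 * (1 + qmass q) ^+ 2.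
  have [|xi /andP[x1 x2] E] := derive_mvt (F := th lam) (f := fun t => rate lam t (th lam t)) ll3.
    by move=> t /andP[lt _]; apply: theta_derive; exact: le_trans lt.
  have xi0 : 0 <= xi by lra.
  have : rate lam xi (th lam xi) <= (1 + qmass q) ^+ 2.
    rewrite /angle_rhs.
    have : (cos (th lam xi) - c xi * sin (th lam xi)) ^+ 2 <= (1 + qmass q) ^+ 2.
      rewrite -real_normK ?num_real // lerXn2r ?nnegrE //; first by lra.
      exact: norm_lin_le1.
    have : 0 <= (xi - lam) * sin (th lam xi) ^+ 2 by rewrite mulr_ge0 ?sqr_ge0 // subr_ge0 ltW.
    lra.
  by move=> h; rewrite addrAC subrr add0r in E; lra.
have km' : k%:R * pi <= m%:R * pi :> R by rewrite ler_pM2r // ler_nat.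
have mj' : m%:R * pi <= j.+1%:R * pi :> R by rewrite ler_pM2r // ler_nat.
have := sqr_ge0 (1 + qmass q).
rewrite -natr1 mulrDl mul1r in k2; rewrite -natr1 mulrDl mul1r in mj'.
by rewrite ler_norml => ?; apply/andP; split; lra.
Qed.

Lemma zeros_asymptotics : exists C, forall lam m, X + 1 <= lam -> zeros hq X lam m ->
  `|m%:R * pi - 2 / 3 * Num.sqrt (lam + 1) ^+ 3| <= C * Num.sqrt (lam + 1) ^+ 2.
Proof.
exists (turning_const + 11 + 3 * (1 + qmass q) ^+ 2) => lam m Xl Hm.
have lam1 : 1 <= lam by have := X0; lra.
have := @zeros_turning lam m _ Hm; have := @theta_turning lam _.
move=> /(_ (lt_le_trans ltr01 lam1)) h1 h2.
have {}h2 : `|m%:R * pi - th lam lam| <= 3 * (1 + qmass q) ^+ 2 + 4 by apply: h2; lra.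
rewrite sqr_sqrtr; last by lra.
have h : 0 <= 3 * (1 + qmass q) ^+ 2 * lam.
  by apply: mulr_ge0; [apply: mulr_ge0; rewrite ?sqr_ge0|lra].
have t0 := turning_const_ge0.
move: h1 h2; rewrite !ler_norml => /andP[? ?] /andP[? ?].
by apply/andP; split; lra.
Qed.

End Phase.

(** * The norm of an eigenfunction *)

Section Norm.
Context {R : realType}.
Variable q : R -> R.
Hypothesis hq : L1_halfline q.
Implicit Types (x y t lam a b e : R).

Notation u lam := (sol hq lam).
Notation v lam := (qsol hq lam).
Notation p lam := (dsol hq lam).
Notation c := (qtail q).
Notation N lam := (sqint hq lam).
Notation J := (qmass q).

Definition energy lam x := p lam x ^+ 2 + (lam - x) * u lam x ^+ 2.
Definition work lam x := rint (fun t => q t * (u lam t * p lam t)) x.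

Lemma cont_updsol lam : cont_ge0 (fun t => u lam t * p lam t).
Proof. by apply: cont_ge0M; [exact: cont_sol|exact: cont_dsol]. Qed.

Lemma lint_work lam : lint (fun t => q t * (u lam t * p lam t)).
Proof. by apply: lintM; [exact: lint_q|exact: cont_updsol]. Qed.

(** Integrated energy balance from [energy 0 = lam]. As [u'] is only absolutely continuous, its
    square goes through [rint_prod], while [(lam - x) u^2] is differentiable; the terms
    [(t - lam) u u'] cancel. *)
Lemma energyE lam x : 0 <= x -> energy lam x = lam - N lam x + 2 * work lam x.
Proof.
move=> x0.
have cu := cont_sol (hq := hq) (lam := lam).
have cp := cont_dsol (hq := hq) (lam := lam).
have IV := @lint_potential _ _ hq lam _ cu.
have IVp := lintM IV cp.
have p2 : p lam x ^+ 2 = rint (fun t => 2 * ((t + q t - lam) * u lam t * p lam t)) x.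
  have := rint_prod 0 0 IV IV x0; rewrite !add0r mul0r add0r -dsolE // -expr2 => ->.
  apply: eq_rint => t t0; rewrite add0r -dsolE //; ring.
have cw : cont_ge0 (fun t => 2 * (lam - t) * (u lam t * p lam t) - u lam t ^+ 2).
  apply: cont_ge0B; last exact: cont_ge0X.
  apply: cont_ge0M; last exact: cont_updsol.
  apply: cont_ge0M; first exact: cont_ge0_cst.
  by apply: cont_ge0B; [exact: cont_ge0_cst|exact: cont_ge0_id].
have u2 : (lam - x) * u lam x ^+ 2 = lam +
    rint (fun t => 2 * (lam - t) * (u lam t * p lam t) - u lam t ^+ 2) x.
  have dw y : 0 <= y -> is_derive y 1 (fun y => (lam - y) * u lam y ^+ 2)
     (2 * (lam - y) * (u lam y * p lam y) - u lam y ^+ 2).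
    move=> y0; have := sol_derive hq lam y0 => ?.
    by apply: is_derive_eq; rewrite /GRing.scale /= /dsol; ring.
  by rewrite (derive_rint cw dw x0) sol_0 expr1n subr0 mulr1; ring.
rewrite /energy p2 u2 sqintE // addrCA; rewrite -addrA; congr (_ + _).
rewrite /work -rintD //; [|exact: lintZ|exact: cont_ge0_lint].
rewrite -rintZ //; last exact: lint_work.
rewrite -[RHS]addrC -rintB //; last 2 first.
- by apply: lintZ; exact: lint_work.
- by apply: cont_ge0_lint; exact: cont_sol2.
by apply: eq_rint => t t0; ring.
Qed.

Lemma work_le lam (M : R) x y : 0 <= x -> x <= y ->
  (forall t, x <= t <= y -> `|u lam t * p lam t| <= M) ->
  `|work lam y - work lam x| <= M * (qabs q y - qabs q x).
Proof.
move=> x0 xy HM; rewrite mulrBr /qabs -!rintZ //; do ?[exact: lint_norm (lint_q hq)|exact: le_trans x0 xy].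
apply: rint_norm_le => //; first exact: lint_work.
  by apply: lintZ; exact: lint_norm (lint_q hq).
by move=> t txy; rewrite normrM mulrC ler_wpM2r // HM.
Qed.

Lemma exists_max_updsol lam b : 0 <= b -> exists x, [/\ 0 <= x, x <= b &
  forall t, 0 <= t <= b -> `|u lam t * p lam t| <= `|u lam x * p lam x|].
Proof.
move=> b0.
have [|x xb Hx] := EVT_max b0 (f := fun t => `|u lam t * p lam t|).
  by apply: cont_ge0_within => //; apply: cont_ge0_norm; exact: cont_updsol.
move: xb; rewrite in_itv /= => /andP[x0 xb]; exists x; split => // t tb; exact: Hx.
Qed.

Lemma work_0 lam : work lam 0 = 0. Proof. exact: rint0. Qed.

(* [1 / 28] is small enough to absorb the term [eps * sup |u u'|] in the a priori
   bound on [sup |u u'|]; any smaller constant would do. *)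
Variables (X eps : R).
Hypothesis X0 : 0 <= X.
Hypothesis eps_small : eps <= 1 / 28.
Hypothesis HX : forall x, X <= x -> J - qabs q x <= eps.

Lemma qtail_eps x : X <= x -> `|c x| <= eps.
Proof. by move=> Xx; apply: le_trans (HX Xx); apply: qtail_le => //; exact: le_trans Xx. Qed.

Lemma qtail_half x : X <= x -> `|c x| <= 1 / 2.
Proof. by move=> /qtail_eps h; apply: (le_trans h); have := eps_small; lra. Qed.

Lemma energy_amgm lam x (r : R) : 0 <= r -> r ^+ 2 <= lam - x ->
  2 * (r * `|u lam x * p lam x|) <= energy lam x.
Proof.
move=> r0 rx; rewrite /energy normrM.
have h : r ^+ 2 * u lam x ^+ 2 <= (lam - x) * u lam x ^+ 2 by rewrite ler_wpM2r ?sqr_ge0.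
have := sqr_ge0 (`|p lam x| - r * `|u lam x|).
rewrite -(real_normK (num_real (p lam x))) -(real_normK (num_real (u lam x))) in h *.
lra.
Qed.

(* Past [lam - 1] both [u v + 2 sqint] and [flux + 4 sqint] increase, and [u v]
   and [flux] are negative at [b]. *)
Lemma updsol_beyond_turning lam b x (T : R) : X + 1 <= lam -> decays hq X lam ->
  forbidden X lam b -> lam - 1 <= x -> x <= b -> N lam b <= T ->
  energy lam (lam - 1) <= T -> `|u lam x * p lam x| <= 13 / 4 * T.
Proof.
move=> lamX Hd fb lx xb NbT Ea; have es := eps_small.
pose a := lam - 1; rewrite -/a in Ea lx.
have Xa : X <= a by rewrite /a; lra.
have a0 := le_trans X0 Xa.
have x0 := le_trans a0 lx.
have Xx := le_trans Xa lx.
have ab : a <= b by exact: le_trans xb.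
have cbound z : a <= z -> [/\ - (1 / 28) <= c z, c z <= 1 / 28 & c z ^+ 2 <= 1 / 28].
  move=> ax; have := qtail_eps (le_trans Xa ax); rewrite ler_norml => /andP[? ?].
  by have := eps_small; split; [lra|lra|nra].
pose h := prodsol hq lam.
have hN z y : a <= z -> z <= y -> h z + 2 * N lam z <= h y + 2 * N lam y.
  move=> ax xy; apply: (derive_ge0_le (F := fun x => h x + 2 * N lam x)
    (f := fun x => v lam x ^+ 2 + (x - lam - c x ^+ 2) * u lam x ^+ 2 + 2 * u lam x ^+ 2)) => //
    t /andP[xt _]; have at_ := le_trans ax xt; have t0 := le_trans a0 at_.
    have := prodsol_derive hq lam t0 => ?; have := sqint_derive hq lam t0 => ?.
    by rewrite /h; apply: is_derive_eq; rewrite /GRing.scale /=; ring.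
  have [_ _ c2] := cbound t at_.
  have : 0 <= (t - lam - c t ^+ 2 + 2) * u lam t ^+ 2.
    by rewrite mulr_ge0 ?sqr_ge0 //; rewrite /a in at_; lra.
  by have := sqr_ge0 (v lam t); lra.
have PN : flux hq lam x + 4 * N lam x <= flux hq lam b + 4 * N lam b.
  apply: (derive_ge0_le (F := fun x => flux hq lam x + 4 * N lam x)
    (f := fun x => (u lam x + v lam x) ^+ 2 +
       (x - lam - c x ^+ 2 - 2 * c x - 1) * u lam x ^+ 2 + 4 * u lam x ^+ 2)) => //
    t /andP[xt _]; have at_ := le_trans lx xt; have t0 := le_trans a0 at_.
    have := flux_derive hq lam t0 => ?; have := sqint_derive hq lam t0 => ?.
    by apply: is_derive_eq; rewrite /GRing.scale /=; ring.
  have [c0 c1 c2] := cbound t at_.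
  have : 0 <= (t - lam - c t ^+ 2 - 2 * c t - 1 + 4) * u lam t ^+ 2.
    by rewrite mulr_ge0 ?sqr_ge0 //; rewrite /a in at_; lra.
  by have := sqr_ge0 (u lam t + v lam t); lra.
have hb := decays_prodsol Hd fb; have Pb := Hd b fb.
have h1 := hN x b lx xb; have h2 := hN a x (lexx a) lx.
have n2 := sqint_ge0 hq lam x0; have na := sqint_ge0 hq lam a0.
have nn := sqint_nd hq lam x0 xb.
have pE z : h z = u lam z * p lam z + c z * u lam z ^+ 2.
  by rewrite /h /prodsol /dsol; ring.
have ha : `|h a| <= T.
  rewrite pE; apply: le_trans Ea.
  have := @energy_amgm lam a 1 ler01; rewrite expr1n mul1r => e1.
  have {}e1 : 2 * `|u lam a * p lam a| <= energy lam a by apply: e1; rewrite /a; lra.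
  have e2 : u lam a ^+ 2 <= energy lam a.
    by rewrite /energy (_ : lam - a = 1); [have := sqr_ge0 (p lam a); lra|rewrite /a; ring].
  apply: (le_trans (ler_normD _ _)).
  have : `|c a * u lam a ^+ 2| <= 1 / 28 * u lam a ^+ 2.
    rewrite normrM (ger0_norm (sqr_ge0 _)) ler_wpM2r ?sqr_ge0 //.
    by apply: le_trans (qtail_eps Xa) _.
  have := sqr_ge0 (u lam a); lra.
(* Lower bound [- T - 2 T] from [hN] on [[a, x]], upper bound [2 T] from [hN] on [[x, b]]. With [PN]
   this gives [u^2 <= 4 T + 3 T], and finally [3 T + 7 T / 28 = 13/4 T]. *)
have hx : `|h x| <= 3 * T.
  move: ha; rewrite !ler_norml -/(h b) in hb * => /andP[? ?].
  by apply/andP; split; lra.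
have ux : u lam x ^+ 2 <= 7 * T.
  rewrite /flux in PN.
  have : flux hq lam x = u lam x ^+ 2 + h x by rewrite /flux /h /prodsol; ring.
  by move: hx; rewrite ler_norml /flux => /andP[? ?] ?; rewrite /flux in Pb; lra.
have -> : u lam x * p lam x = h x - c x * u lam x ^+ 2 by rewrite pE; ring.
apply: (le_trans (ler_normB _ _)).
have : `|c x * u lam x ^+ 2| <= 1 / 28 * (7 * T).
  rewrite normrM (ger0_norm (sqr_ge0 _)); apply: ler_pM; rewrite ?sqr_ge0 //.
  by apply: le_trans (qtail_eps Xx) _.
lra.
Qed.

Lemma solution_norm lam (s : R) : 1 <= s -> 2 * J <= s -> s ^+ 2 <= lam - X ->
  decays hq X lam -> exists M, [/\ 0 <= M, s * M <= lam &
   `|\int[mu]_(t in `[0, +oo[) u lam t ^+ 2 - lam| <=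
     2 + 2 * J * M + 10 * eps * (lam + 1 + 2 * J * M)].
Proof.
move=> s1 Js sX Hd.
have J0 := qmass_ge0 q.
have s2 : 1 <= s ^+ 2 by apply: exprn_ege1.
have lamX : X + 1 <= lam by lra.
have eps0 : 0 <= eps by apply: le_trans (qtail_eps (lexx X)).
have [x1 [x10 x1X Hx1]] := exists_max_updsol lam X0.
set M := `|u lam x1 * p lam x1| in Hx1.
have M0 : 0 <= M by exact: normr_ge0.
have work1 x : 0 <= x -> x <= X -> `|work lam x| <= J * M.
  move=> x0 xX; have := @work_le lam M 0 x (lexx 0) x0.
  rewrite work_0 subr0 mulrC => h; apply: (le_trans (h _)).
    by move=> t /andP[t0 tx]; apply: Hx1; rewrite t0 (le_trans tx).
  by rewrite ler_wpM2r // /qabs rint0 subr0; exact: qabs_le.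
(* Energy at the maximum point gives [2 s M <= lam + 2 J M], and [2 J <= s] absorbs the last
   term. *)
have sM : s * M <= lam.
  have h1 := @energy_amgm lam x1 s (le_trans ler01 s1).
  have {}h1 : 2 * (s * M) <= energy lam x1 by apply: h1; lra.
  have h2 := energyE lam x10; have h3 := sqint_ge0 hq lam x10.
  have := work1 x1 x10 x1X; rewrite ler_norml => /andP[_ h4].
  have : 2 * J * M <= s * M by rewrite ler_wpM2r.
  lra.
exists M; split => //.
set Nt := Rintegral _ _ _.
have I2 := decays_integrable X0 qtail_half Hd.
have Il2 := cont_ge0_lint (cont_sol2 (hq := hq) (lam := lam)).
have [|B0 B00 HB0] := rint_halfline_tail Il2 _ I2 ltr01.
  by move=> t _; exact: sqr_ge0.
have [b [Bb fb _ Tb]] := tailnorm_small X0 qtail_half B0 Hd Hd ltr01.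
have b0 := forbidden_ge0 X0 fb.
have /andP[Xb lb] := fb.
have Nb1 : Nt - 1 < N lam b by rewrite sqintE //; exact: HB0.
have Nb2 : N lam b <= Nt by exact: integrable_sqint.
rewrite /tailnorm in Tb.
have Eb : `|energy lam b| <= 1.
  have cb : c b ^+ 2 <= 1 / 4.
    by have := qtail_half Xb; rewrite ler_norml => /andP[? ?]; nra.
  have h1 : p lam b ^+ 2 <= 2 * v lam b ^+ 2 + u lam b ^+ 2.
    have : c b ^+ 2 * u lam b ^+ 2 <= 1 / 4 * u lam b ^+ 2 by rewrite ler_wpM2r ?sqr_ge0.
    have := sqr_ge0 (v lam b + c b * u lam b); have := sqr_ge0 (u lam b).
    by rewrite /dsol; lra.
  have h2 : 3 * u lam b ^+ 2 <= (b - lam) * u lam b ^+ 2 by rewrite ler_wpM2r ?sqr_ge0 //; lra.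
  have := sqr_ge0 (v lam b); have := sqr_ge0 (u lam b); have := sqr_ge0 (p lam b).
  by rewrite /energy ler_norml => ? ? ?; apply/andP; split; lra.
have [x2 [x20 x2b Hx2]] := exists_max_updsol lam b0.
set M2 := `|u lam x2 * p lam x2| in Hx2.
have M20 : 0 <= M2 by exact: normr_ge0.
have work2 x : X <= x -> x <= b -> `|work lam x| <= J * M + eps * M2.
  move=> Xx xb; rewrite -(subrK (work lam X) (work lam x)) addrC.
  apply: (le_trans (ler_normD _ _)); apply: lerD; first exact: work1.
  apply: (le_trans (work_le (M := M2) X0 Xx _)).
    by move=> t /andP[Xt tx]; apply: Hx2; rewrite (le_trans X0 Xt) (le_trans tx).
  rewrite mulrC ler_wpM2r //.
  have := HX (lexx X); have := qabs_le hq (le_trans X0 Xx); lra.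
pose B := lam + 1 + 2 * J * M.
have JM : 0 <= J * M by exact: mulr_ge0.
pose T := B + 2 * (eps * M2).
have eM : 0 <= eps * M2 by exact: mulr_ge0.
have NbT : N lam b <= T.
  have h := energyE lam b0; have := work2 b Xb (lexx b).
  move: Eb; rewrite !ler_norml => /andP[? ?] /andP[? ?].
  by rewrite /T /B; lra.
have ET x : X <= x -> x <= b -> energy lam x <= T.
  move=> Xx xb; have x0 := le_trans X0 Xx.
  have h := energyE lam x0; have := work2 x Xx xb; have := sqint_ge0 hq lam x0.
  by rewrite ler_norml /T /B => ? /andP[? ?]; lra.
have M_lam : M <= lam by apply: le_trans sM; rewrite ler_peMl.
(* The maximum over [[0, b]] may fall in three ranges: up to [X] it is [M <= lam]; up to [lam - 1]
   the energy bounds it; beyond that, [updsol_beyond_turning] does. *)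
have M2T : M2 <= 13 / 4 * T.
  have T0 : 0 <= T by rewrite /T /B; lra.
  have [x2X|/ltW Xx2] := leP x2 X.
    have : M2 <= M by apply: Hx1; rewrite x20.
    by rewrite /T /B; lra.
  have [x2l|/ltW lx2] := leP x2 (lam - 1).
    have := @energy_amgm lam x2 1 ler01; rewrite expr1n mul1r -/M2 => h.
    have := ET x2 Xx2 x2b; have : 2 * M2 <= energy lam x2 by apply: h; lra.
    lra.
  by apply: (updsol_beyond_turning lamX Hd fb lx2 x2b NbT); apply: ET; lra.
(* Absorption: [M2 <= 13/4 B + 13/2 eps M2] with [eps <= 1/28] leaves [M2 <= 5 B]. *)
have eB : eps * M2 <= 5 * (eps * B).
  have h1 : eps * M2 <= 1 / 28 * M2 by rewrite ler_wpM2r.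
  have h2 : M2 <= 5 * B by rewrite /T in M2T; lra.
  by have := ler_wpM2l eps0 h2; lra.
have h := energyE lam b0; have := work2 b Xb (lexx b).
move: Eb; rewrite !ler_norml /B in eB * => /andP[? ?] /andP[? ?].
by apply/andP; split; lra.
Qed.

End Norm.

Lemma eigenfunction_norm (R : realType) (q : R -> R) (hq : L1_halfline q) (eta : R) :
  0 < eta -> exists L : R, forall lam : R, L <= lam -> neumann_eigenvalue q lam ->
  `|\int[@lebesgue_measure R]_(t in `[0, +oo[) sol hq lam t ^+ 2 - lam| <= eta * lam.
Proof.
move=> eta0.
(* The final budget is [d lam + d lam + 10 (eta / 60) (3 lam)], at most [3/4 eta lam]. Here [eps] is
   fixed first because [X] depends on it, and [s] is chosen so that [2 J M <= d s M <= d lam]. *)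
pose eps := Num.min (1 / 28) (eta / 60).
have eps0 : 0 < eps by rewrite lt_min !divr_gt0.
have e1 : eps <= 1 / 28 by rewrite ge_min lexx.
have e2 : eps <= eta / 60 by rewrite ge_min lexx orbT.
have [X X0 HX] := qabs_tail hq eps0.
have HX' x : X <= x -> qmass q - qabs q x <= eps by move=> /HX/ltW.
pose d := Num.min 1 (eta / 8).
have d0 : 0 < d by rewrite lt_min ltr01 divr_gt0.
have d1 : d <= 1 by rewrite ge_min lexx.
have d2 : d <= eta / 8 by rewrite ge_min lexx orbT.
have J0 := qmass_ge0 q.
pose s := 1 + 2 * qmass q / d.
have Jd : 0 <= 2 * qmass q / d by rewrite divr_ge0 ?mulr_ge0 // ltW.
have s1 : 1 <= s by rewrite lerDl.
have ds : 2 * qmass q <= d * s.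
  by rewrite /s mulrDr mulr1 mulrCA divff ?gt_eqF // mulr1 lerDr ltW.
have Js : 2 * qmass q <= s by apply: (le_trans ds); rewrite ler_piMl //; lra.
exists (X + s ^+ 2 + 2 / d) => lam Ll Hev.
have dd : 0 < 2 / d by rewrite divr_gt0.
have s20 := sqr_ge0 s.
have sX : s ^+ 2 <= lam - X by lra.
have Hd : decays hq X lam.
  by apply/(eigenvalue_decays hq X0 (qtail_half hq X0 e1 HX')).
have [M [M0 sM]] := solution_norm X0 e1 HX' s1 Js sX Hd.
move=> H; apply: (le_trans H).
have JM : 2 * qmass q * M <= d * lam.
  apply: (@le_trans _ _ (d * s * M)); first by rewrite ler_wpM2r.
  by rewrite -mulrA ler_wpM2l // ltW.
have l2 : 2 <= d * lam.
  by rewrite -ler_pdivrMl // mulrC; lra.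
have lam0 : 0 <= lam by lra.
have h1 : d * lam <= eta / 8 * lam by rewrite ler_wpM2r.
have h2 : d * lam <= lam by rewrite ler_piMl.
have h3 : eps * (lam + 1 + 2 * qmass q * M) <= eta / 60 * (3 * lam).
  apply: ler_pM => //; [exact: ltW| |lra].
  by have := mulr_ge0 J0 M0; lra.
have := mulr_ge0 (ltW eta0) lam0; lra.
Qed.

(** * Asymptotics *)

Section Assembly.
Context {R : realType}.

Lemma cvg_of_eps (f : nat -> R) (l : R) :
  (forall e : R, 0 < e -> exists M : nat, forall n, (M <= n)%N -> `|f n - l| <= e) ->
  f n @[n --> \oo] --> l.
Proof.
move=> H; apply/cvgrPdist_le => e e0; have [M HM] := H e e0.
by exists M => // n /= Mn; rewrite distrC; exact: HM.
Qed.

Variable q : R -> R.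
Hypothesis hq : L1_halfline q.

Lemma exists_small_qtail : exists2 X : R, 0 <= X &
  forall x : R, X <= x -> `|qtail q x| <= 1 / 2.
Proof.
have h2 : 0 < 1 / 2 :> R by lra.
have [X X0 HX] := qabs_tail hq h2; exists X => // x Xx.
by apply: le_trans (ltW (HX x Xx)); apply: qtail_le => //; exact: le_trans Xx.
Qed.

Variable lam : nat -> R.
Hypothesis hinc : forall n, lam n < lam n.+1.
Hypothesis henum : forall l, neumann_eigenvalue q l <-> exists n, lam n = l.

Lemma lam_mono (m n : nat) : (m <= n)%N -> lam m <= lam n.
Proof.
by move=> mn; apply: (homo_leq (@lexx _ R) (@le_trans _ R) _ mn) => k; exact: ltW.
Qed.

(** The count rises by exactly one between consecutive eigenvalues; the number [m0] of zeros of the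
    lowest eigenfunction is left undetermined. *)
Lemma eigenvalue_count : exists X : R, exists m0 : nat, [/\ 0 <= X,
  forall x : R, X <= x -> `|qtail q x| <= 1 / 2 &
  forall n, zeros hq X (lam n) (m0 + n)].
Proof.
have [X X0 HX] := exists_small_qtail.
have Hd n : decays hq X (lam n).
  by apply/(eigenvalue_decays hq X0 HX)/henum; exists n.
have [Z HZ] := choice (fun n => exists_zeros hq X0 HX (lam n)).
exists X, (Z 0%N); split => // n; elim: n => [|n IH]; first by rewrite addn0.
rewrite addnS; have <- : Z n.+1 = (Z 0%N + n).+1; last exact: HZ.
apply/eqP; rewrite eqn_leq; apply/andP; split.
  apply: (zeros_step X0 HX (hinc n) _ IH (HZ n.+1)) => l /andP[l1 l2].
  move=> /(eigenvalue_decays hq X0 HX)/henum[k E].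
  have [kn|nk] := leqP k n.
    by have := lam_mono kn; rewrite E leNgt l1.
  by have := lam_mono nk; rewrite E leNgt l2.
have h := zeros_strict X0 HX (hinc n) (Hd n) (Hd n.+1) IH (HZ n.+1).
exact: h.
Qed.

(** Eigenvalues below [L] have no more zeros than the solution at [L], which bounds their
    indices. *)
Lemma lam_unbounded (L : R) : exists M : nat, forall n, (M <= n)%N -> L <= lam n.
Proof.
have [X [m0 [X0 HX HZ]]] := eigenvalue_count.
have [M HM] := exists_zeros hq X0 HX L.
exists M.+1 => n Mn; rewrite leNgt; apply/negP => nL.
have := zeros_mono X0 (ltW nL) (HZ n) HM.
by move=> h; have := leq_trans (leq_addl m0 n) h; rewrite leqNgt Mn.
Qed.

(** Replacing [m0 + n] by [n + 1 - 3/4] shifts the phase by [(m0 - 1/4) pi], absorbed into [C]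
    because [lam n + 1 >= 1]. *)
Lemma eigenvalue_asymptotics : exists C L : R, forall n, L <= lam n ->
  `|Num.sqrt (lam n + 1) ^+ 3 - 3 / 2 * pi * (n.+1%:R - 3 / 4)|
     <= C * Num.sqrt (lam n + 1) ^+ 2.
Proof.
have [X [m0 [X0 HX HZ]]] := eigenvalue_count.
have [C HC] := zeros_asymptotics hq X0 HX.
exists (3 / 2 * (C + (m0%:R + 1) * pi)), (X + 1) => n Ln.
have := HC _ _ Ln (HZ n); set k := Num.sqrt _ => H.
have k2 : 1 <= k ^+ 2 by rewrite sqr_sqrtr; lra.
have pi0 := pi_gt0 R.
have m00 : 0 <= m0%:R :> R by [].
have mp : 0 <= m0%:R * pi :> R by rewrite mulr_ge0 // ltW.
have h1 : (m0%:R + 1) * pi <= (m0%:R + 1) * pi * k ^+ 2.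
  by rewrite ler_peMr //; lra.
move: H; rewrite natrD -[n.+1%:R]natr1 !ler_norml => /andP[h2 h3].
by apply/andP; split; lra.
Qed.

Lemma eigenvalue_ratio_cvg :
  (3 / 2 * pi * (n.+1%:R - 3 / 4)) / Num.sqrt (lam n + 1) ^+ 3 @[n --> \oo] --> (1 : R).
Proof.
have [C [L H]] := eigenvalue_asymptotics.
apply: cvg_of_eps => e e0.
(* The relative error is [C / k]; [lam n >= (|C| / e)^2] makes it at most [e]. *)
have [M HM] := lam_unbounded (Num.max L ((`|C| / e) ^+ 2)).
exists M => n /HM; rewrite ge_max => /andP[/H {}H ln].
set k := Num.sqrt _ in H *; set y := 3 / 2 * pi * _ in H *.
have c0 : 0 <= `|C| / e by rewrite divr_ge0 // ltW.
have l0 : 0 <= lam n by apply: le_trans ln; exact: sqr_ge0.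
have k0 : 0 < k by rewrite sqrtr_gt0; lra.
have Ck : `|C| <= e * k.
  rewrite mulrC -ler_pdivrMr // -(ger0_norm c0) -sqrtr_sqr.
  by apply: ler_wsqrtr; lra.
have -> : y / k ^+ 3 - 1 = (y - k ^+ 3) / k ^+ 3 by field; rewrite gt_eqF.
rewrite normrM normfV (gtr0_norm (exprn_gt0 3 k0)) ler_pdivrMr ?exprn_gt0 //.
rewrite distrC; apply: (le_trans H).
have -> : e * k ^+ 3 = e * k * k ^+ 2 by ring.
rewrite ler_wpM2r ?sqr_ge0 //; apply: le_trans Ck; exact: ler_norm.
Qed.

Lemma norm_ratio_cvg (nu : nat -> R) :
  (forall n, nu n = \int[@lebesgue_measure R]_(t in `[0, +oo[) sol hq (lam n) t ^+ 2) ->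
  nu n / Num.sqrt (lam n + 1) ^+ 2 @[n --> \oo] --> (1 : R).
Proof.
move=> Hnu; apply: cvg_of_eps => e e0.
have e20 : 0 < e / 2 by lra.
have [L HL] := eigenfunction_norm hq e20.
have [M HM] := lam_unbounded (Num.max L (2 / e)).
exists M => n /HM; rewrite ge_max => /andP[Ln le].
have ev : neumann_eigenvalue q (lam n) by apply/henum; exists n.
have := HL _ Ln ev; rewrite -Hnu => H.
have e2 : 0 < 2 / e by rewrite divr_gt0.
have h1 : 1 <= e / 2 * lam n.
  by have := ler_wpM2l (ltW e20) le; rewrite mulrA divfK ?gt_eqF // divff // gt_eqF.
rewrite sqr_sqrtr; last by lra.
have l1 : 0 < lam n + 1 by lra.
have -> : nu n / (lam n + 1) - 1 = (nu n - lam n - 1) / (lam n + 1) by field; rewrite gt_eqF.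
rewrite normrM normfV (gtr0_norm l1) ler_pdivrMr //.
by move: H; rewrite !ler_norml => /andP[? ?]; apply/andP; split; lra.
Qed.

Lemma powR23_cvg (z : nat -> R) :
  z n @[n --> \oo] --> (1 : R) -> z n `^ (2 / 3) @[n --> \oo] --> (1 : R).
Proof.
move=> z1; have dp := @is_derive1_powR R (2 / 3) 1 ltr01.
have cp : {for 1, continuous (fun a : R => a `^ (2 / 3))} := is_derive_continuous dp.
have := continuous_cvg _ cp z1; rewrite powR1; exact.
Qed.

(** Both [nu / k^2] and [(y / k^3)^(2/3)] tend to 1, and [k] cancels in their quotient since
    [(k^3)^(2/3) = k^2]. *)
Lemma norming_asymptotics (nu : nat -> R) :
  (forall n, nu n = \int[@lebesgue_measure R]_(t in `[0, +oo[) sol hq (lam n) t ^+ 2) ->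
  nu n / (3 / 2 * pi * (n.+1%:R - 3 / 4)) `^ (2 / 3) @[n --> \oo] --> (1 : R).
Proof.
move=> Hnu.
have h1 := norm_ratio_cvg Hnu; have h2 := powR23_cvg eigenvalue_ratio_cvg.
have h3 : (nu n / Num.sqrt (lam n + 1) ^+ 2) *
   (((3 / 2 * pi * (n.+1%:R - 3 / 4)) / Num.sqrt (lam n + 1) ^+ 3) `^ (2 / 3))^-1
   @[n --> \oo] --> (1 * 1^-1 : R).
  by apply: cvgM => //; apply: cvgV => //; exact: oner_neq0.
rewrite invr1 mulr1 in h3.
apply: cvg_trans h3; apply: near_eq_cvg.
have [M HM] := lam_unbounded 0.
exists M => // n /= /HM l0.
set k := Num.sqrt _; set y := 3 / 2 * pi * _.
have k0 : 0 < k by rewrite sqrtr_gt0; lra.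
have n1 : 1 <= n.+1%:R :> R by rewrite ler1n.
have y0 : 0 < y by rewrite !mulr_gt0 ?pi_gt0 //; lra.
have k3 : (k ^+ 3) `^ (2 / 3) = k ^+ 2.
  rewrite -[k ^+ 3]powR_mulrn ?ltW // -powRrM -[RHS]powR_mulrn ?ltW //.
  by congr (_ `^ _); field.
have -> : y = (y / k ^+ 3) * k ^+ 3 by rewrite divfK // gt_eqF // exprn_gt0.
rewrite [in RHS]powRM ?exprn_ge0 ?divr_ge0 ?(ltW k0) ?(ltW y0) ?exprn_ge0 ?(ltW k0) //.
rewrite k3 divfK ?gt_eqF ?exprn_gt0 // -mulrA -invfM.
by rewrite [k ^+ 2 * _]mulrC.
Qed.

End Assembly.

(* lam n = lambda^N_{n+1}, phi n = a nonzero eigenfunction for lam n;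
   k = n+1. *)
Theorem theorem3p9 (R : realType) (q : R -> R) (hq : L1_halfline q)
    (lam : nat -> R)
    (hinc : forall n, lam n < lam n.+1)
    (henum : forall l, neumann_eigenvalue q l <-> exists n, lam n = l)
    (phi : nat -> R -> R)
    (hphi : forall n, neumann_eigenfunction q (lam n) (phi n)) :
  (fun n : nat => (inv_norming (phi n) /
      (3 / 2 * pi * (n.+1%:R - 3 / 4)) `^ (2 / 3) : R)) @ \oo --> (1 : R).
Proof.
apply: (norming_asymptotics hinc henum) => n.
exact: (inv_norming_sol hq (hphi n)).
Qed.
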